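(* (i) For $1\le p<\infty$, $c_{\ell_p}(D_k^\omega)\approx k^{1/p}$. (ii) For $1<p<\infty$, $c_{L_p}(D_k^\omega)\approx\min\{k^{1/p},\sqrt{k}\}$. Here $k\in\mathbb{N}$, and $A\approx B$ denotes equivalence up to universal constant factors.
   Context: $\mathbb{N}=\{1,2,\dots\}$ and $L_p=L_p[0,1]$. Asymptotic notation: $A\lesssim B$ and $A\gtrsim B$ denote the corresponding inequalities up to universal constant factors, and $A\approx B$ means that both $A\lesssim B$ and $A\gtrsim B$ hold. Distortion: for metric spaces $(X,d_X)$, $(Y,d_Y)$, $c_Y(X)$ is the infimum of all $D\ge 1$ for which there are $s>0$ and $f\colon X\to Y$ with $s\,d_X(x,y)\le d_Y(f(x),f(y))\le D s\,d_X(x,y)$ for all $x,y\in X$ (and $c_Y(X)=\infty$ if there is none). Countably branching diamond graphs: $D_0^\omega$ is the graph with two vertices joined by an edge. For $k\ge 0$, $D_{k+1}^\omega$ is obtained from $D_k^\omega$ by removing each edge $\{u,v\}$ and adding instead a countably infinite set of new vertices (disjoint sets for distinct edges), each joined by an edge to $u$ and to $v$ and to nothing else. The metric space $D_k^\omega$ is its vertex set with the shortest path metric, edges having length one.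
   Formalization: In (ii) the lower-bound constant is not universal over all 1<p<∞ (false as p→1, e.g. p=1+1/k gives bounded distortion): for each p0>1 one constant c(p0)>0 serves all p≥p0 and all k; the upper constant in (ii) and both constants in (i) are universal. *)

(* Defs.v *)
From HB Require Import structures.
From mathcomp Require Import all_boot all_order all_algebra.
From mathcomp Require Import all_classical all_reals all_analysis.

Set Implicit Arguments.
Unset Strict Implicit.
Unset Printing Implicit Defensive.

Import Order.TTheory GRing.Theory Num.Theory.
Import numFieldNormedType.Exports.

Local Open Scope classical_set_scope.
Local Open Scope ring_scope.

(* The infimum is +oo when X has no bi-Lipschitz embedding into Y. *)
Definition distortion (R : realType) (X Y : metricType R) : \bar R :=
  ereal_inf [set D%:E | D in [set D : R | 1 <= D /\
    exists s (f : X -> Y), 0 < s /\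
      forall x y, s * mdist x y <= mdist (f x) (f y) <= D * s * mdist x y]].

Record graph := Graph { vertex :> Type; adj : vertex -> vertex -> Prop }.

Fixpoint walk (G : graph) (n : nat) (x y : G) : Prop :=
  if n is m.+1 then exists2 z, adj x z & walk m z y else x = y.

(* The default value 0 is only reached when no walk joins x to y. *)
Definition gdist (G : graph) (x y : G) : nat :=
  xget 0 [set n | walk n x y /\ forall m, walk m x y -> (n <= m)%N].

(* An undirected edge is the set of its two endpoints. *)
Definition edge (G : graph) : Type :=
  {e : set G | exists u v, adj u v /\ e = [set u; v]}.

(* The vertex inr (e, i) is the i-th of the new vertices replacing e. *)
Definition subdivide_adj (G : graph) (x y : G + edge G * nat) : Prop :=
  match x, y with
  | inl u, inr (e, _) | inr (e, _), inl u => sval e u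
  | _, _ => False
  end.

Definition subdivide (G : graph) : graph := Graph (@subdivide_adj G).

Definition single_edge : graph := Graph (fun x y : bool => x <> y).

Definition diamond_graph (k : nat) : graph := iter k subdivide single_edge.

Lemma walk_cat (G : graph) n m (x y z : G) :
  walk n x y -> walk m y z -> walk (n + m) x z.
Proof.
elim: n x => [x -> //|n IHn x [w xw wy] yz]; exists w => //; exact: IHn.
Qed.

Lemma walk_sym (G : graph) n (x y : G) :
  (forall u v : G, adj u v -> adj v u) -> walk n x y -> walk n y x.
Proof.
move=> s; elim: n x => [//|n IHn x [w xw wy]]; rewrite -addn1.
by apply: walk_cat (IHn _ wy) _; exists x => //; exact: s.
Qed.

Lemma gdistP (G : graph) (x y : G) : (exists n, walk n x y) ->
  walk (gdist x y) x y /\ forall m, walk m x y -> (gdist x y <= m)%N.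
Proof.
move=> [n xy]; rewrite /gdist; case: xgetP => [d _ //|/(_ _)].
have ex : exists n, `[< walk n x y >] by exists n; apply/asboolP.
case: (ex_minnP ex) => m /asboolP xm mP /(_ m) []; split => // j.
by move/asboolP; exact: mP.
Qed.

Lemma diamond_adj_sym k (u v : diamond_graph k) : adj u v -> adj v u.
Proof.
case: k u v => [u v /= /nesym //|k u v].
by case: u v => [u|[e i]] [v|[f j]].
Qed.

Lemma subdivide_walk (G : graph) n (x y : G) :
  walk n x y -> exists m, walk (G := subdivide G) m (inl x) (inl y).
Proof.
elim: n x => [x ->|n IHn x [z xz /IHn[m zy]]]; first by exists 0.
have ee : exists u v, adj u v /\ [set x; z] = [set u; v] by exists x, z.
exists m.+2; exists (inr (exist _ [set x; z] ee, 0)) => /=; first by left.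
by exists (inl z) => //=; right.
Qed.

Lemma diamond_connected k (x y : diamond_graph k) : exists n, walk n x y.
Proof.
elim: k x y => [|k IHk] x y.
  have [->|/eqP xy] := eqVneq (x : bool) y; first by exists 0.
  by exists 1, y.
have near_old (z : diamond_graph k.+1) :
    exists n (u : diamond_graph k), walk n z (inl u).
  case: z => [u|[[e eE] i]]; first by exists 0, u.
  have [u [v [_ euv]]] := eE.
  by exists 1, u, (inl u) => //=; rewrite euv; left.
have [n [u xu]] := near_old x; have [m [v yv]] := near_old y.
have [l uv] := IHk u v; have [j {}uv] := subdivide_walk uv.
exists (n + (j + m)); apply: walk_cat xu _; apply: walk_cat uv _.
by apply: walk_sym yv; exact: diamond_adj_sym.
Qed.

(* R is only the field in which the metric takes its values. *)
Definition diamond (R : realType) (k : nat) : Type := diamond_graph k.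

Section diamond_metric.
Variables (R : realType) (k : nat).
Implicit Types x y z : diamond R k.

Definition diamond_dist x y : R := (@gdist (diamond_graph k) x y)%:R.

Let dP x y := gdistP (@diamond_connected k x y).

Let dist_xx x : diamond_dist x x = 0.
Proof.
apply/eqP; rewrite /diamond_dist pnatr_eq0 -leqn0.
by have [_] := dP x x; apply.
Qed.

Let dist_positivity x y : diamond_dist x y = 0 -> x = y.
Proof.
move=> /eqP; rewrite /diamond_dist pnatr_eq0 => /eqP d0.
by have [] := dP x y; rewrite d0.
Qed.

Let dist_sym x y : diamond_dist x y = diamond_dist y x.
Proof.
congr _%:R; apply/eqP; rewrite eqn_leq.
by apply/andP; split; apply: (dP _ _).2; apply: walk_sym (dP _ _).1;
  exact: diamond_adj_sym.
Qed.

Let dist_triangle y x z :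
  diamond_dist x z <= diamond_dist x y + diamond_dist y z.
Proof.
rewrite /diamond_dist -natrD ler_nat; apply: (dP _ _).2.
exact: walk_cat (dP _ _).1 (dP _ _).1.
Qed.

HB.instance Definition _ := gen_eqMixin (diamond R k).
HB.instance Definition _ := gen_choiceMixin (diamond R k).
HB.instance Definition _ := isMetric.Build R (diamond R k)
  dist_xx dist_positivity dist_sym dist_triangle.

End diamond_metric.

Definition Lp_space d (T : measurableType d) (R : realType)
    (mu : {measure set T -> \bar R}) (p : R) (p1 : (1 <= p%:E)%E) : Type :=
  LspaceType mu p1.

Section Lp_metric.
Context d (T : measurableType d) (R : realType).
Variables (mu : {measure set T -> \bar R}) (p : R) (p1 : (1 <= p%:E)%E).
Implicit Types f g h : Lp_space mu p1.

(* Elements of Lp_space are classes modulo equality mu-almost everywhere;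
   Lp_fun picks a representative. *)
Definition Lp_fun f : T -> R := (f : LspaceType mu p1).

Definition Lp_dist f g : R :=
  fine 'N[mu]_p%:E[EFin \o (Lp_fun f \- Lp_fun g)%R]%E.

Let Lp_rep f : {mfun T >-> measurableTypeR R} :=
  repr ((f : LspaceType mu p1) : {mfun_ mu, T >-> measurableTypeR R}).

Let Lfun_rep f : Lp_fun f \in Lfun mu p%:E.
Proof.
rewrite inE /=; apply/andP; split; rewrite inE /=.
  exact: (@measurable_funPT _ _ _ _ (Lp_rep f)).
exact: (@Lebesgue_finite _ _ _ _ _ _ f).
Qed.

Let F f : LfunType mu p1 := Lfun_Sub p1 (Lfun_rep f).

Let distE f g : Lp_dist f g = fine 'N[mu]_p%:E[EFin \o (F f - F g)%R]%E.
Proof. by []. Qed.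

Let dist_xx f : Lp_dist f f = 0.
Proof.
rewrite distE subrr -[RHS]/(fine 0%E); congr fine.
by rewrite -[LHS]/('N[mu]_p%:E[cst 0%E])%E Lnorm0// gt_eqF// (lt_le_trans _ p1).
Qed.

Let dist_positivity f g : Lp_dist f g = 0 -> f = g.
Proof.
rewrite distE => /fine_Lnormr_eq0 fg.
have {}fg : ae_eq mu setT (Lp_rep f) (Lp_rep g).
  by apply: filterS fg => x /(_ I) /eqP; rewrite subr_eq0 => /eqP.
have : (f : LspaceType mu p1) = (g : LspaceType mu p1)
    :> {mfun_ mu, T >-> measurableTypeR R}.
  rewrite -[LHS]reprK -[RHS]reprK; apply/eqmodP.
  by apply/asboolP.
case: f g {fg} => f [[pf]] [g [[pg]]] /= fg.
by move: pf pg; rewrite fg => pf pg; rewrite (Prop_irrelevance pf pg).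
Qed.

Let dist_sym f g : Lp_dist f g = Lp_dist g f.
Proof. by rewrite !distE -(LnormrN (F f - F g)) -[in RHS]opprB. Qed.

Let dist_triangle g f h : Lp_dist f h <= Lp_dist f g + Lp_dist g h.
Proof. by rewrite !distE -(subrKA (F g)) ler_LnormD. Qed.

HB.instance Definition _ := gen_eqMixin (Lp_space mu p1).
HB.instance Definition _ := gen_choiceMixin (Lp_space mu p1).
HB.instance Definition _ := isMetric.Build R (Lp_space mu p1)
  dist_xx dist_positivity dist_sym dist_triangle.

End Lp_metric.

Definition lp (R : realType) (p : R) (p1 : (1 <= p%:E)%E) : metricType R :=
  Lp_space (@counting nat R) p1.

Definition unit_interval_measure (R : realType) :
    {measure set (measurableTypeR R) -> \bar R} :=
  mrestr (@lebesgue_measure R) (measurable_itv `[0, 1]).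

Definition Lp01 (R : realType) (p : R) (p1 : (1 <= p%:E)%E) : metricType R :=
  Lp_space (unit_interval_measure R) p1.

(* Main.v *)
(* Every vertex x of D_k has integer coordinates: its height, and for each level
   j and each arm number i the "tent" min(d(x,u), d(x,v)) if x lies in the i-th
   arm of the level-j subdiamond with poles u, v that contains it, and 0
   otherwise. Two vertices are never farther apart than the sum of split_edge
   coordinate differences, while along an edge only k + 1 coordinates change,
   each by at most one. Mapping the coordinates to disjointly supported unit
   vectors embeds D_k with distortion O(k^(1/p)); mapping them to the bounded
   orthogonal functions cos(2 pi n t) gives O(sqrt k) in L_p for p <= 2.

   Conversely, suppose that for two points u, v and any dl-separated sequence
   (a_i) some a_i satisfies
     d(u,v)^q + c dl^q <= max(2 d(u,a_i), 2 d(a_i,v))^q.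
   Descending from an edge to the best of its halves, level by level, yields
   an edge stretched by at least (1 + c 2^-q k)^(1/q). In L_p this property
   follows from Clarkson's inequality (p >= 2, q = p) or from the two-point
   inequality (p < 2, q = 2). In l_p it holds with q = p for all p because two
   of the infinitely many a_i almost coincide on any finite set of
   coordinates. *)
Require Import Defs.
From HB Require Import structures.
From mathcomp Require Import all_boot all_order all_algebra.
From mathcomp Require Import all_classical all_reals all_analysis.
From mathcomp Require Import measurable_realfun zify lra ring.

Import Order.TTheory GRing.Theory Num.Theory.
Import numFieldNormedType.Exports.

Local Open Scope classical_set_scope.
Local Open Scope ring_scope.

Set Implicit Arguments.
Unset Strict Implicit.
Unset Printing Implicit Defensive.

(** * Coordinates on the diamond graphs *)

Local Open Scope nat_scope.

Section edge_ends.
Variable G : graph.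

Lemma edge_ends_proof (e : edge G) :
  exists uv : G * G, adj uv.1 uv.2 /\ sval e = [set uv.1; uv.2].
Proof. by case: e => e [u [v uv]] /=; exists (u, v). Qed.

(** An undirected edge has no first end: [cid] fixes an arbitrary order, and the coordinates below
    use the two ends symmetrically. *)
Definition edge_ends (e : edge G) : G * G := sval (cid (edge_ends_proof e)).

Lemma adj_edge_ends (e : edge G) : adj (edge_ends e).1 (edge_ends e).2.
Proof. by rewrite /edge_ends; case: cid => x []. Qed.

Lemma sval_edge (e : edge G) : sval e = [set (edge_ends e).1; (edge_ends e).2].
Proof. by rewrite /edge_ends; case: cid => x []. Qed.

Lemma edge_inj (e f : edge G) : sval e = sval f -> e = f.
Proof.
by case: e f => [e p] [f q] /= ef; subst f; rewrite (Prop_irrelevance p q).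
Qed.

Lemma edge_endsP (u v : G) (e : edge G) : sval e = [set u; v] ->
  edge_ends e = (u, v) \/ edge_ends e = (v, u).
Proof.
rewrite sval_edge; case: (edge_ends e) => a b /= /seteqP[ab uv].
have [ua|ua] : [set a; b] u by apply: uv; left.
- have [vb|vb] : [set a; b] v by apply: uv; right.
  + have [//|] := ab b (or_intror erefl); first by rewrite ua vb; left; congr pair.
    by rewrite ua => ->; left; rewrite vb.
  + by left; rewrite ua vb.
- have [vb|vb] : [set a; b] v by apply: uv; right.
  + by right; rewrite ua vb.
  + have [|] := ab a (or_introl erefl); last by rewrite ua vb => ->; left.
    by rewrite ua vb => ->; left.
Qed.

End edge_ends.

(* Coordinate 0 is the height; coordinate [2 i + 1] is new at each subdivision
   and singles out the arms numbered [i], while the older coordinates [n] move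
   to [2 n] and are rescaled by 2. *)
Definition subdivide_coords (G : graph) (t : G -> nat -> nat)
    (x : subdivide G) (n : nat) : nat :=
  match x with
  | inl u => if odd n then 0 else (t u n./2).*2
  | inr (e, i) => if odd n then (n./2 == i) : nat
      else (t (edge_ends e).1 n./2 + t (edge_ends e).2 n./2)
  end.

Fixpoint coords (k : nat) : diamond_graph k -> nat -> nat :=
  match k with
  | 0 => fun b n => (b : bool) && (n == 0)
  | k.+1 => @subdivide_coords (diamond_graph k) (@coords k)
  end.

Definition old k (u : diamond_graph k) : diamond_graph k.+1 := inl u.

Definition mid k (e : edge (diamond_graph k)) (i : nat) : diamond_graph k.+1 :=
  inr (e, i).

Definition up k (u v : diamond_graph k) :=
  adj u v /\ coords v 0 = (coords u 0).+1.

Lemma mid_coords k (u v : diamond_graph k) (e : edge (diamond_graph k)) i n :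
  sval e = [set u; v] -> coords (mid e i) n =
  if odd n then (n./2 == i) : nat else (coords u n./2 + coords v n./2).
Proof.
by move=> /edge_endsP[] /= ->; case: ifP => //= _; rewrite addnC.
Qed.

Lemma old_coords k (u : diamond_graph k) n :
  coords (old u) n = if odd n then 0 else (coords u n./2).*2.
Proof. by []. Qed.

(** The height of a new vertex is the sum of the heights of the ends of its edge, while each end
    gets twice its own height. The ends differ by one, hence so do the new neighbours. *)
Lemma adj_sym_coords k (u v : diamond_graph k) : adj u v ->
  (coords v 0 == (coords u 0).+1) || (coords u 0 == (coords v 0).+1).
Proof.
elim: k u v => [[] [] /= h|k IHk] //; try by case: h.
have key (u : diamond_graph k) (e : edge (diamond_graph k)) i : sval e u ->
    (coords (mid e i) 0 == (coords (old u) 0).+1) ||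
    (coords (old u) 0 == (coords (mid e i) 0).+1).
  have := IHk _ _ (adj_edge_ends e).
  rewrite (mid_coords _ _ (sval_edge e)) /= sval_edge.
  by move=> + [] ->; lia.
move=> [u|[e i]] [v|[f j]] //= h; first exact: (key u f j).
by rewrite orbC; exact: (key v e i).
Qed.

Lemma adj_up k (u v : diamond_graph k) : adj u v -> up u v \/ up v u.
Proof.
move=> uv; have /orP[/eqP h|/eqP h] := adj_sym_coords uv; first by left.
by right; split => //; exact: diamond_adj_sym.
Qed.

Lemma edge_up k (e : edge (diamond_graph k)) :
  exists u v, up u v /\ sval e = [set u; v].
Proof.
have := sval_edge e; set u := _.1; set v := _.2 => euv.
have [uv|vu] := adj_up (adj_edge_ends e); first by exists u, v.
by exists v, u; rewrite euv setUC.
Qed.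

Lemma exists_adj k (x : diamond_graph k) : exists y, adj x y.
Proof.
elim: k x => [[]|k IHk [u|[e i]]]; [by exists false|by exists true| |].
- have [v uv] := IHk u.
  have ee : exists u0 v0, adj u0 v0 /\ [set u; v] = [set u0; v0] by exists u, v.
  by exists (inr (exist _ [set u; v] ee, 0%N)) => /=; left.
- by exists (inl (edge_ends e).1) => /=; rewrite sval_edge; left.
Qed.

Lemma coords_finite k (x : diamond_graph k) :
  exists N, forall n, (N <= n) -> coords x n = 0.
Proof.
elim: k x => [b|k IHk [u|[e i]]].
- by exists 1 => n; case: n => //= n _; rewrite andbF.
- have [N HN] := IHk u; exists N.*2 => n Nn /=; case: ifP => // _.
  by rewrite HN//; lia.
- have [N HN] := IHk (edge_ends e).1; have [M HM] := IHk (edge_ends e).2.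
  exists (maxn (maxn N M).*2 i.*2.+2) => n Nn /=.
  by case: ifP => _; [lia|rewrite HN ?HM; lia].
Qed.

Definition within_one (a b : nat) := ((a <= b.+1) && (b <= a.+1)).

(** Each subdivision adds one changing coordinate. From u to a new vertex on the edge uv, an old
    coordinate t goes from 2 t(u) to t(u) + t(v), a change of t(v) - t(u); among the fresh odd
    coordinates only that of the arm moves, from 0 to 1. *)
Lemma adj_coords k (u v : diamond_graph k) : adj u v ->
  (forall n, within_one (coords u n) (coords v n)) /\
  exists2 s : seq nat, (size s <= k.+1) &
    forall n, n \notin s -> coords u n = coords v n.
Proof.
elim: k u v => [u v uv|k IHk].
  split=> [n|]; first by rewrite /within_one /=; lia.
  by exists [:: 0%N] => // n; rewrite inE /= => /negbTE ->; rewrite !andbF.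
have key (u : diamond_graph k) (e : edge (diamond_graph k)) i : sval e u ->
  (forall n, within_one (coords (old u) n) (coords (mid e i) n)) /\
  exists2 s : seq nat, (size s <= k.+2) & forall n, n \notin s ->
    coords (old u) n = coords (mid e i) n.
  have [cl [s ss sE]] := IHk _ _ (adj_edge_ends e).
  rewrite sval_edge => eu; split=> [n|].
    rewrite (mid_coords _ _ (sval_edge e)) old_coords; have := cl n./2.
    by rewrite /within_one; case: eu => ->; case: odd; lia.
  exists (i.*2.+1 :: [seq n.*2 | n <- s]); first by rewrite /= size_map.
  move=> n; rewrite inE negb_or => /andP[ni ns].
  rewrite (mid_coords _ _ (sval_edge e)) old_coords; case: ifPn => on.
    by apply/esym/eqP; rewrite eqb0; lia.
  have : n./2 \notin s.
    by apply: contra ns => ns; apply/mapP; exists n./2 => //; lia.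
  by move=> /sE h; case: eu => ->; lia.
move=> [u|[e i]] [v|[f j]] //= h; first exact: (key u f j).
have [h1 [s ss h2]] := key v e i h; split.
  by move=> n; have := h1 n; rewrite /within_one andbC.
by exists s => // n /h2 /esym.
Qed.

(** * Graph distance and its behaviour under subdivision *)

Lemma dist_le_walk k (x y : diamond_graph k) m : walk m x y -> (gdist x y <= m).
Proof. exact: (gdistP (@diamond_connected k x y)).2. Qed.

Lemma dist_walk k (x y : diamond_graph k) : walk (gdist x y) x y.
Proof. exact: (gdistP (@diamond_connected k x y)).1. Qed.

Lemma dist_triangle k (y x z : diamond_graph k) :
  (gdist x z <= gdist x y + gdist y z).
Proof. exact/dist_le_walk/walk_cat/dist_walk/dist_walk. Qed.

Lemma dist_xx k (x : diamond_graph k) : gdist x x = 0.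
Proof. by apply/eqP; rewrite -leqn0; exact: dist_le_walk. Qed.

Lemma distC k (x y : diamond_graph k) : gdist x y = gdist y x.
Proof.
by apply/eqP; rewrite eqn_leq; apply/andP; split; apply/dist_le_walk/walk_sym;
  [exact: diamond_adj_sym|exact: dist_walk|exact: diamond_adj_sym|exact: dist_walk].
Qed.

Lemma dist_adj k (x y : diamond_graph k) : adj x y -> (gdist x y <= 1).
Proof. by move=> xy; apply: dist_le_walk; exists y. Qed.

Lemma dist_coords k (x y : diamond_graph k) n :
  (coords x n <= coords y n + gdist x y).
Proof.
move: (gdist x y) (dist_walk x y) => m; elim: m x => [x -> |m IHm x [z xz zy]].
  by rewrite addn0.
have := IHm _ zy; have [/(_ n)] := adj_coords xz; rewrite /within_one; lia.
Qed.

(** Each edge of a shortest walk is replaced by the two edges through the new vertex number 0 on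
    it. *)
Lemma dist_inl k (x y : diamond_graph k) :
  (gdist (old x) (old y) <= (gdist x y).*2).
Proof.
move: (gdist x y) (dist_walk x y) => m; elim: m x => [x ->|m IHm x [z xz zy]].
  by rewrite dist_xx.
have ee : exists u v, adj u v /\ [set x; z] = [set u; v] by exists x, z.
pose w := mid (exist _ [set x; z] ee) 0.
have xw : gdist (old x) w <= 1 by apply: dist_adj => /=; left.
have wz : gdist w (old z) <= 1 by apply: dist_adj => /=; right.
have := IHm _ zy.
have := dist_triangle w (old x) (old y); have := dist_triangle (old z) w (old y).
lia.
Qed.

Lemma dist_mid k (u : diamond_graph k) (e : edge (diamond_graph k)) i
    (y : diamond_graph k.+1) : sval e u ->
  gdist (mid e i) y <= (gdist (old u) y).+1.
Proof.
move=> eu; have := dist_triangle (old u) (mid e i) y.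
have : gdist (mid e i) (old u) <= 1 by exact: dist_adj.
lia.
Qed.

Lemma old_even k (u : diamond_graph k) z :
  coords (old u) z.*2 = (coords u z).*2.
Proof. by rewrite old_coords odd_double doubleK. Qed.

Lemma old_odd k (u : diamond_graph k) z : coords (old u) z.*2.+1 = 0.
Proof. by rewrite old_coords /= odd_double. Qed.

Lemma mid_even k (u v : diamond_graph k) (e : edge (diamond_graph k)) i z :
  sval e = [set u; v] -> coords (mid e i) z.*2 = coords u z + coords v z.
Proof. by move=> euv; rewrite (mid_coords _ _ euv) odd_double doubleK. Qed.

Lemma mid_odd k (e : edge (diamond_graph k)) i z :
  coords (mid e i) z.*2.+1 = (z == i).
Proof.
by rewrite (mid_coords _ _ (sval_edge e)) /= odd_double /= uphalf_double.
Qed.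

Lemma up_split k (x y : diamond_graph k.+1) : up x y ->
  exists (u v : diamond_graph k) (e : edge (diamond_graph k)) i,
  [/\ up u v, sval e = [set u; v] &
    (x = old u /\ y = mid e i) \/ (x = mid e i /\ y = old v)].
Proof.
case: x y => [u|[e i]] [v|[f j]] [] // h.
- have [a [b [ab fab]]] := edge_up f.
  rewrite -/(old u) -/(mid f j) (mid_even j 0 fab) (old_even u 0).
  move: h; rewrite /= fab => -[] ->.
    by exists a, b, f, j; split=> //; left.
  by case: ab => _ ->; lia.
- have [a [b [ab eab]]] := edge_up e.
  rewrite -/(old v) -/(mid e i) (mid_even i 0 eab) (old_even v 0).
  move: h; rewrite /= eab => -[] ->.
    by case: ab => _ ->; lia.
  by exists a, b, e, i; split=> //; right.
Qed.

(* A pair of vertices is either at distance the difference of their heights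
   ([None]), or it lies in two different arms, recorded by the coordinates [z]
   and [w], of a subdiamond whose poles have heights [h0] and [h0 + 2 H]. *)
Definition in_arm k (z w H h0 : nat) (x : diamond_graph k) :=
  [/\ h0 <= coords x 0, coords x 0 <= h0 + H.*2,
    coords x z = minn (coords x 0 - h0) (h0 + H.*2 - coords x 0) &
    coords x w = 0].

(** One of the two truncated differences vanishes, so their sum is the absolute height
    difference. *)
Definition vertical k (x y : diamond_graph k) :=
  gdist x y <= (coords x 0 - coords y 0) + (coords y 0 - coords x 0).

(** The last two bounds are the lengths of the routes through the lower and the upper pole, the
    second rearranged to avoid truncated subtraction. *)
Definition separated k (z w H h0 : nat) (x y : diamond_graph k) :=
  [/\ in_arm z w H h0 x, in_arm w z H h0 y,
    gdist x y <= (coords x 0 - h0) + (coords y 0 - h0) &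
    gdist x y + coords x 0 + coords y 0 <= h0.*2 + H.*2.*2].

Definition related k (c : option (nat * nat * nat * nat))
    (x y : diamond_graph k) :=
  if c is Some (z, w, H, h0) then separated z w H h0 x y else vertical x y.

(** One code serves all four pairs of ends. The induction needs this uniformity, as a new vertex is
    compared through both ends of its edge. *)
Definition edges_related k (u v u' v' : diamond_graph k) := exists c,
  forall x y, [set u; v] x -> [set u'; v'] y -> related c x y.

Lemma in_arm_old k z w H h0 (u : diamond_graph k) : in_arm z w H h0 u ->
  in_arm z.*2 w.*2 H.*2 h0.*2 (old u).
Proof.
move=> [h1 h2 h3 h4]; split; rewrite ?old_even ?(old_even u 0) ?h3 ?h4; lia.
Qed.

(** The tent is linear between the consecutive heights of [u] and [v], because its kink [h0 + H] is
    an integer; so adding the values at the two ends gives the doubled tent at the new vertex. *)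
Lemma in_arm_mid k z w H h0 (u v : diamond_graph k)
    (e : edge (diamond_graph k)) i : up u v -> sval e = [set u; v] ->
  in_arm z w H h0 u -> in_arm z w H h0 v ->
  in_arm z.*2 w.*2 H.*2 h0.*2 (mid e i).
Proof.
move=> [_ uv] euv [h1 h2 h3 h4] [h1' h2' h3' h4'].
split; rewrite ?(mid_even _ _ euv) ?(mid_even i 0 euv) ?h3 ?h4 ?h3' ?h4'; lia.
Qed.

Definition double_code (c : option (nat * nat * nat * nat)) :=
  if c is Some (z, w, H, h0) then Some (z.*2, w.*2, H.*2, h0.*2) else None.

Lemma related_sym k (u v u' v' : diamond_graph k) :
  edges_related u v u' v' -> edges_related u' v' u v.
Proof.
move=> [[[[[z w] H] h0]|] h].
  exists (Some (w, z, H, h0)) => x y hx hy.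
  have [h1 h2 h3 h4] := h y x hy hx; split=> //; rewrite distC; lia.
by exists None => x y hx hy; have := h y x hy hx; rewrite /= /vertical distC; lia.
Qed.

Definition split_edge k (u v : diamond_graph k) (e : edge (diamond_graph k)) i :=
  [set old u; mid e i; old v].

(** Old distances at most double and a new vertex is one step from either end of its edge, so both
    kinds of relation pass to the subdivided edges with the code doubled. *)
Lemma related_step k (u v u' v' : diamond_graph k)
    (e e' : edge (diamond_graph k)) i i' :
  up u v -> up u' v' -> sval e = [set u; v] -> sval e' = [set u'; v'] ->
  e <> e' -> edges_related u v u' v' -> exists c,
  forall x y, split_edge u v e i x -> split_edge u' v' e' i' y -> related c x y.
Proof.
move=> uv uv' E E' ee' [c hc]; exists (double_code c).
have [_ vu] := uv; have [_ vu'] := uv'.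
have eu : sval e u by rewrite E; left.
have ev : sval e v by rewrite E; right.
have eu' : sval e' u' by rewrite E'; left.
have ev' : sval e' v' by rewrite E'; right.
have hm : coords (mid e i) 0 = (coords u 0).*2.+1.
  by rewrite (mid_even i 0 E) vu; lia.
have hm' : coords (mid e' i') 0 = (coords u' 0).*2.+1.
  by rewrite (mid_even i' 0 E') vu'; lia.
have ho (a : diamond_graph k) : coords (old a) 0 = (coords a 0).*2.
  exact: (old_even a 0).
have r1 := hc u u' (or_introl erefl) (or_introl erefl).
have r2 := hc u v' (or_introl erefl) (or_intror erefl).
have r3 := hc v u' (or_intror erefl) (or_introl erefl).
have r4 := hc v v' (or_intror erefl) (or_intror erefl).
have d1 := dist_inl u u'; have d2 := dist_inl u v'.
have d3 := dist_inl v u'; have d4 := dist_inl v v'.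
have m1 y := dist_mid i y eu; have m2 y := dist_mid i y ev.
have m1' y : gdist y (mid e' i') <= (gdist y (old u')).+1.
  by rewrite distC (distC y); exact: dist_mid.
have m2' y : gdist y (mid e' i') <= (gdist y (old v')).+1.
  by rewrite distC (distC y); exact: dist_mid.
have := m1 (old u'); have := m1 (old v'); have := m2 (old u').
have := m2 (old v'); have := m1' (old u); have := m1' (old v).
have := m2' (old u); have := m2' (old v).
have := m1 (mid e' i'); have := m2 (mid e' i').
have := m1' (mid e i); have := m2' (mid e i).
move=> {m1 m2 m1' m2'} q1 q2 q3 q4 q5 q6 q7 q8 q9 q10 q11 q12.
case: c r1 r2 r3 r4 {hc} => [[[[z w] H] h0]|] /=.
- move=> [A1 B1 C1 D1] [A2 B2 C2 D2] [A3 B3 C3 D3] [A4 B4 C4 D4].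
  have [? ? _ _] := A1; have [? ? _ _] := A3.
  have [? ? _ _] := B1; have [? ? _ _] := B2.
  move=> x y [[]|] -> [[]|] ->;
    split; do ?[exact: in_arm_old|exact: (in_arm_mid _ uv E)
               |exact: (in_arm_mid _ uv' E')];
    rewrite ?hm ?hm' ?ho; lia.
- rewrite /vertical => C1 C2 C3 C4.
  (* At equal heights the lower ends would coincide, and so would the upper ends, contradicting
     [e <> e']. Thus one edge lies above the other, and routes through the facing ends realize the
     height difference. *)
  have uu' : coords u 0 <> coords u' 0.
    move=> h; apply: ee'; apply: edge_inj; rewrite E E'.
    have -> : u = u' by have := dist_walk u u'; have -> : gdist u u' = 0 by lia.
    have -> // : v = v'.
    by have := dist_walk v v'; have -> : gdist v v' = 0 by lia.
  by move=> x y [[]|] -> [[]|] ->; rewrite ?hm ?hm' ?ho; lia.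
Qed.

(** For [i = i'] there is a single path of length two. Otherwise the new vertices lie in different
    arms of the subdiamond with poles [old u] and [old v], which has [H = 1], and [i.*2.+1],
    [i'.*2.+1] are the coordinates of these arms. *)
Lemma related_same_edge k (u v : diamond_graph k)
    (e : edge (diamond_graph k)) i i' :
  up u v -> sval e = [set u; v] -> exists c,
  forall x y, split_edge u v e i x -> split_edge u v e i' y -> related c x y.
Proof.
move=> uv E; have [auv vu] := uv.
have eu : sval e u by rewrite E; left.
have ev : sval e v by rewrite E; right.
have hm j : coords (mid e j) 0 = (coords u 0).*2.+1.
  by rewrite (mid_even j 0 E) vu; lia.
have ho (a : diamond_graph k) : coords (old a) 0 = (coords a 0).*2.
  exact: (old_even a 0).
have d1 j : gdist (mid e j) (old u) <= 1 by exact: dist_adj.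
have d2 j : gdist (mid e j) (old v) <= 1 by exact: dist_adj.
have d3 j : gdist (old u) (mid e j) <= 1 by exact: dist_adj.
have d4 j : gdist (old v) (mid e j) <= 1 by exact: dist_adj.
have := dist_triangle (mid e i) (old u) (old v).
have := dist_triangle (old u) (mid e i) (mid e i').
have := d1 i; have := d2 i; have := d3 i; have := d4 i.
have := d1 i'; have := d2 i'; have := d3 i'; have := d4 i'.
have := distC (old u) (old v).
move=> {d1 d2 d3 d4} q1 q2 q3 q4 q5 q6 q7 q8 q9 q10 q11.
have duu := dist_xx (old u); have dvv := dist_xx (old v).
have [ii'|ii'] := eqVneq i i'.
  exists None; have dmm := dist_xx (mid e i'); move=> x y [[]|] -> [[]|] -> /=;
  by rewrite /vertical ?hm ?ho -?ii'; subst i'; lia.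
exists (Some (i.*2.+1, i'.*2.+1, 1, (coords u 0).*2)).
by move=> x y [[]|] -> [[]|] ->; split; do ?split;
  rewrite ?mid_odd ?old_odd ?hm ?ho ?eqxx ?(eq_sym i') ?(negbTE ii'); lia.
Qed.

(** Induction on the level: both edges are halves of parent edges. Distinct parents pass on their
    code doubled; a common parent produces a fresh code. *)
Lemma up_edges_related k (u v u' v' : diamond_graph k) :
  up u v -> up u' v' -> edges_related u v u' v'.
Proof.
elim: k u v u' v' => [|k IHk] u v u' v'.
  move=> [_ h] [_ h']; exists None => x y _ _; rewrite /= /vertical.
  have [->|xy] := pselect (x = y); first by rewrite dist_xx.
  have : gdist x y <= 1 by exact: dist_adj.
  by move: x y xy => [] [] //= _; lia.
move=> /up_split[a [b [e [i [ab E H]]]]] /up_split[a' [b' [e' [i' [ab' E' H']]]]].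
suff [c hc] : exists c, forall x y,
    split_edge a b e i x -> split_edge a' b' e' i' y -> related c x y.
  have s1 : [set u; v] `<=` split_edge a b e i.
    by case: H => -[-> ->] _ [] ->; [left; left|left; right|left; right|right].
  have s2 : [set u'; v'] `<=` split_edge a' b' e' i'.
    by case: H' => -[-> ->] _ [] ->; [left; left|left; right|left; right|right].
  by exists c => x y /s1 hx /s2 hy; exact: hc.
have [ee'|ee'] := pselect (e = e'); last exact/related_step/IHk.
subst e'; have aa' : a = a' /\ b = b'.
  have [_ h] := ab; have [_ h'] := ab'.
  have /edge_endsP H1 := E; have /edge_endsP := E'.
  by case: H1 => -> [] [? ?]; subst; split => //; lia.
by case: aa' => ? ?; subst a' b'; exact: related_same_edge.
Qed.

Lemma exists_up k (x : diamond_graph k) :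
  exists u v, up u v /\ [set u; v] x.
Proof.
have [y xy] := exists_adj x; have [h|h] := adj_up xy.
  by exists x, y; split=> //; left.
by exists y, x; split=> //; right.
Qed.

(** The height difference and the two tents add up to at least the distance, so one of the three is
    at least a third of it. On equal slopes the route through the nearer pole shows this; on
    opposite slopes the sum is 2 H, the average length of the two routes. *)
Lemma coords_dist k (x y : diamond_graph k) : exists n,
  gdist x y <= 3 * ((coords x n - coords y n) + (coords y n - coords x n)).
Proof.
have [u [v [uv ux]]] := exists_up x; have [u' [v' [uv' uy]]] := exists_up y.
have [c /(_ _ _ ux uy)] := up_edges_related uv uv'.
pose D n := (coords x n - coords y n) + (coords y n - coords x n).
case: c => [[[[z w] H] h0]|]; last by rewrite /= /vertical => h; exists 0; lia.
move=> [[a1 a2 a3 a4] [b1 b2 b3 b4] d1 d2].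
have dl : gdist x y <= D 0 + D z + D w by rewrite /D; lia.
have [h0m|h0m] := leqP (gdist x y) (3 * D 0); first by exists 0.
have [hzm|hzm] := leqP (gdist x y) (3 * D z); first by exists z.
by exists w; rewrite -/(D w); lia.
Qed.

Local Open Scope ring_scope.

(** * Distortion of the diamond graphs *)

Section distortion_bounds.
Variables (R : realType).
Implicit Types (Y : metricType R) (q c : R).

Lemma diamond_mdist k (x y : diamond R k) :
  mdist x y = (@gdist (diamond_graph k) x y)%:R.
Proof. by []. Qed.

(** Polynomials serve as finitely supported real sequences, so that coordinate vectors can be
    subtracted. *)
Definition coords_poly k (x : diamond_graph k) : {poly R} :=
  \poly_(i < sval (cid (coords_finite x))) (coords x i)%:R.

Lemma coef_coords_poly k (x : diamond_graph k) n :
  (coords_poly x)`_n = (coords x n)%:R.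
Proof.
rewrite coef_poly; case: ltnP => //; case: cid => N /= HN Nn.
by rewrite HN.
Qed.

Lemma mdist_walk k Y (f : diamond_graph k -> Y) (L : R) : 0 <= L ->
  (forall x y, adj x y -> mdist (f x) (f y) <= L) ->
  forall x y, mdist (f x) (f y) <= L * (gdist x y)%:R.
Proof.
move=> L0 fL x y; move: (gdist x y) (dist_walk x y) => m.
elim: m x => [x ->|m IHm x [z xz zy]]; first by rewrite mdistxx mulr0.
rewrite (le_trans (metric_triangle _ (f z) _))// -natr1 mulrDr mulr1 addrC.
by rewrite lerD ?fL ?IHm.
Qed.

(** Some coordinate carries a third of the distance, and along an edge at most k + 1 coordinates
    change, each by at most one. The factor 6 is this 3 times the 2 in (k+1)^(1/q) <= 2 k^(1/q). *)
Lemma distortion_diamond_le k Y (F : {poly R} -> Y) (al be q : R) :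
  (0 < k)%N -> 0 < al -> al <= be -> 1 <= q ->
  (forall (P Q : {poly R}) n, al * `|P`_n - Q`_n| <= mdist (F P) (F Q)) ->
  (forall (P Q : {poly R}) (s : seq nat), (forall n, `|P`_n - Q`_n| <= 1) ->
    (forall n, n \notin s -> P`_n = Q`_n) ->
    mdist (F P) (F Q) <= be * (size s)%:R `^ q^-1) ->
  (distortion (diamond R k) Y <= (6 * (be / al) * k%:R `^ q^-1)%:E)%E.
Proof.
move=> k0 al0 albe q1 Flo Fup.
have q0 : 0 < q by rewrite (lt_le_trans ltr01).
have be0 : 0 < be by rewrite (lt_le_trans al0).
have kq1 : 1 <= k%:R `^ q^-1 :> R.
  apply: (@le_trans _ _ (1 `^ q^-1)); first by rewrite powR1.
  by rewrite ge0_ler_powR ?invr_ge0 ?nnegrE ?(ltW q0)// ler1n.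
have kk : (k.+1)%:R `^ q^-1 <= 2 * k%:R `^ q^-1 :> R.
  apply: (@le_trans _ _ ((2 * k%:R) `^ q^-1)).
    rewrite ge0_ler_powR ?invr_ge0 ?nnegrE ?mulr_ge0 ?(ltW q0)//.
    by rewrite -natrM ler_nat; lia.
  rewrite powRM// ler_wpM2r ?powR_ge0// ler1_powR ?ler1n// invf_le1//.
apply: ereal_inf_lbound; exists (6 * (be / al) * k%:R `^ q^-1) => //=; split.
  have : 1 <= be / al by rewrite ler_pdivlMr// mul1r.
  move=> h; apply: mulr_ege1 => //; apply: mulr_ege1 => //; by rewrite ler1n.
exists (al / 3), (fun x : diamond R k => F (@coords_poly k x)).
split=> [|x y]; first by rewrite divr_gt0.
rewrite diamond_mdist; apply/andP; split.
  have [n hn] := coords_dist (x : diamond_graph k) y.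
  apply: le_trans (Flo _ _ n); rewrite !coef_coords_poly.
  rewrite -mulrA ler_pM2l// ler_pdivrMl//.
  apply: (@le_trans _ _
    (3 * ((coords (x : diamond_graph k) n - coords (y : diamond_graph k) n)
    + (coords (y : diamond_graph k) n - coords (x : diamond_graph k) n)))%:R).
    by rewrite ler_nat.
  rewrite natrM ler_pM2l//.
  have [h|h] := leqP (coords (x : diamond_graph k) n)
                     (coords (y : diamond_graph k) n).
    rewrite (eqP h) add0n natrB// distrC ger0_norm// subr_ge0 ler_nat//.
  have h' := ltnW h; rewrite (eqP h') addn0 natrB// ger0_norm//.
  by rewrite subr_ge0 ler_nat.
apply: (@le_trans _ _ (be * k.+1%:R `^ q^-1 * (@gdist (diamond_graph k) x y)%:R)).
  apply: (@mdist_walk k Y (fun x => F (coords_poly x))).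
    by rewrite mulr_ge0 ?powR_ge0// ltW.
  move=> {}x {}y xy; have [cl [s ss sE]] := adj_coords xy.
  apply: (le_trans (Fup _ _ s _ _)).
  - move=> n; rewrite !coef_coords_poly.
    have /andP[] := cl n; rewrite -!(ler_nat R) -!natr1 => h1 h2.
    by rewrite ler_norml; apply/andP; split; lra.
  - by move=> n /sE; rewrite !coef_coords_poly => ->.
  - rewrite ler_pM2l// ge0_ler_powR ?invr_ge0 ?nnegrE ?(ltW q0)//.
    by rewrite ler_nat.
rewrite ler_wpM2r//.
have -> : 6 * (be / al) * k%:R `^ q^-1 * (al / 3) = be * (2 * k%:R `^ q^-1).
  by field; rewrite gt_eqF.
by rewrite ler_pM2l.
Qed.

(** A sequence is required instead of a pair: in l_1 both (1,0) and (0,1) are midpoints of (0,0) and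
    (1,1). *)
Definition convex_midpoints Y (q c : R) := forall (u v : Y) (a : nat -> Y) dl,
  0 < dl -> (forall i j, i <> j -> dl <= mdist (a i) (a j)) ->
  exists i, mdist u v `^ q + c * dl `^ q <=
    Num.max (2 * mdist u (a i)) (2 * mdist (a i) v) `^ q.

(** The hypothesis on [f] speaks of coordinates because these double exactly under subdivision: the
    restriction to old vertices satisfies it with 2 s. The arms of the long edge found there are
    s-separated by their odd coordinates, and the gain c s^q is (2 s)^q times c / 2^q. *)
Lemma long_edge k Y q c (f : diamond_graph k -> Y) s : 0 < q ->
  convex_midpoints Y q c -> 0 < s ->
  (forall x y n, s * `|(coords x n)%:R - (coords y n)%:R| <= mdist (f x) (f y)) ->
  exists x y, adj x y /\
    s `^ q * (1 + c / 2 `^ q * k%:R) <= mdist (f x) (f y) `^ q.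
Proof.
move=> q0 conv; elim: k f s => [|k IHk] f s s0 fs.
  exists false, true; split=> //; rewrite mulr0 addr0 mulr1.
  rewrite ge0_ler_powR ?nnegrE ?mdist_ge0 ?(ltW q0) ?(ltW s0)//.
  apply: le_trans (fs _ _ 0%N); rewrite /= sub0r normrN normr1 mulr1//.
have [||x [y [xy Hxy]]] := IHk (f \o @old k) (2 * s); first by rewrite mulr_gt0.
  move=> x y n; apply: le_trans (fs _ _ n.*2).
  rewrite !old_even -!muln2 !natrM -mulrBl normrM [`|2%:R|]ger0_norm//.
  by rewrite le_eqVlt; apply/orP; left; apply/eqP; ring.
have ee : exists u v, adj u v /\ [set x; y] = [set u; v] by exists x, y.
pose e : edge (diamond_graph k) := exist _ [set x; y] ee.
have sep i j : i <> j -> s <= mdist (f (mid e i)) (f (mid e j)).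
  move=> ij; apply: le_trans (fs _ _ i.*2.+1); rewrite !mid_odd eqxx.
  by rewrite (introF eqP ij) subr0 normr1 mulr1.
have [i Hi] := conv (f (old x)) (f (old y)) (fun i => f (mid e i)) _ s0 sep.
have {}Hi : (2 * s) `^ q * (1 + c / 2 `^ q * k.+1%:R) <=
    Num.max (2 * mdist (f (old x)) (f (mid e i)))
            (2 * mdist (f (mid e i)) (f (old y))) `^ q.
  apply: le_trans Hi; apply: le_trans (lerD Hxy (lexx _)).
  rewrite powRM// ?(ltW s0)// -natr1 le_eqVlt; apply/orP; left; apply/eqP.
  by field; rewrite gt_eqF// powR_gt0.
have p2 : 0 < 2 `^ q :> R by rewrite powR_gt0.
have key A : 0 <= A -> (2 * s) `^ q * (1 + c / 2 `^ q * k.+1%:R) <= (2 * A) `^ q ->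
    s `^ q * (1 + c / 2 `^ q * k.+1%:R) <= A `^ q.
  by move=> A0; rewrite !powRM// ?(ltW s0)// -mulrA ler_pM2l.
have [m|m] := leP (2 * mdist (f (old x)) (f (mid e i)))
                  (2 * mdist (f (mid e i)) (f (old y))).
- move: Hi; rewrite (max_idPr m) => Hi; exists (mid e i), (old y); split.
    by right.
  by apply: key => //; exact: mdist_ge0.
- move: Hi; rewrite (max_idPl (ltW m)) => Hi; exists (old x), (mid e i); split.
    by left.
  by apply: key => //; exact: mdist_ge0.
Qed.

(** The image of an edge has length at most D s, so the long edge forces 1 + c k / 2^q <= D^q.
    Dropping the 1 and taking roots leaves the factor 1/2. *)
Lemma distortion_diamond_ge k Y q c : 0 < q -> 0 <= c ->
  convex_midpoints Y q c ->
  (((c * k%:R) `^ q^-1 / 2)%:E <= distortion (diamond R k) Y)%E.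
Proof.
move=> q0 c0 conv; apply: le_ereal_inf_tmp => _ [D [D1 [s [f [s0 fD]]]] <-].
rewrite lee_fin.
have D0 : 0 < D by rewrite (lt_le_trans ltr01).
have [x y n|x [y [xy Hxy]]] := @long_edge k Y q c f s q0 conv s0 _.
  have /andP[+ _] := fD x y; apply: le_trans.
  have := dist_coords (x : diamond_graph k) y n.
  have := dist_coords (y : diamond_graph k) x n.
  rewrite distC -!(ler_nat R) !natrD => h1 h2.
  by rewrite ler_pM2l// diamond_mdist ler_norml; apply/andP; split; lra.
have /andP[_] := fD x y; rewrite diamond_mdist => up.
have {}up : mdist (f x) (f y) <= D * s.
  apply: (le_trans up); rewrite -[leRHS]mulr1 ler_pM2l ?mulr_gt0//.
  by rewrite -[1]/(1%:R) ler_nat dist_adj.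
have p2 : 0 < 2 `^ q :> R by rewrite powR_gt0.
have h : c * k%:R <= (2 * D) `^ q.
  have : s `^ q * (1 + c / 2 `^ q * k%:R) <= s `^ q * D `^ q.
    rewrite (le_trans Hxy)// -powRM ?(ltW s0) ?(ltW D0)// mulrC.
    by rewrite ge0_ler_powR ?nnegrE ?mdist_ge0 ?(ltW q0)// mulr_ge0 ?ltW.
  rewrite ler_pM2l ?powR_gt0// => h.
  have -> : c * k%:R = 2 `^ q * (c / 2 `^ q * k%:R) by field; rewrite gt_eqF.
  by rewrite powRM ?(ltW D0)// ler_pM2l//; apply: le_trans h; rewrite lerDr.
have : (c * k%:R) `^ q^-1 <= ((2 * D) `^ q) `^ q^-1.
  by rewrite ge0_ler_powR ?invr_ge0 ?nnegrE ?powR_ge0 ?mulr_ge0 ?(ltW q0).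
rewrite -powRrM mulfV ?gt_eqF// powRr1 ?mulr_ge0 ?(ltW D0)// => H.
by rewrite ler_pdivrMr// (mulrC D).
Qed.

End distortion_bounds.

(** * Power inequalities *)

Section power_inequalities.
Variable R : realType.
Implicit Types (a b p q r s t x y u v A B : R).

Lemma powR_le_inv p a b : 0 < p -> 0 <= a -> 0 <= b ->
  a `^ p <= b `^ p -> a <= b.
Proof.
move=> p0 a0 b0 ab.
have : (a `^ p) `^ p^-1 <= (b `^ p) `^ p^-1.
  by rewrite ge0_ler_powR ?nnegrE ?powR_ge0 ?invr_ge0 ?(ltW p0).
by rewrite -!powRrM mulfV ?gt_eqF// !powRr1.
Qed.

Lemma powR_sqr_norm x p : (x ^+ 2) `^ (p / 2) = `|x| `^ p.
Proof.
rewrite -real_normK ?num_real// -powR_mulrn// -powRrM; congr (_ `^ _).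
by rewrite mulrC divfK.
Qed.

Lemma powR_norm_midpoint p x y : 1 <= p ->
  `|x + y| `^ p <= 2 `^ p / 2 * (`|x| `^ p + `|y| `^ p).
Proof.
move=> p1; have p0 : 0 < p by rewrite (lt_le_trans ltr01).
have h : (2^-1 * `|x| + 2^-1 * `|y|) `^ p <=
    2^-1 * `|x| `^ p + 2^-1 * `|y| `^ p.
  rewrite {2 4}(_ : 2^-1 = 1 - 2^-1); last by lra.
  by apply: (convex_powR p1 (Itv01 _ _)) => //=;
    rewrite ?inE/= ?in_itv/= ?normr_ge0// ?invr_ge0// invf_le1 ?ler1n.
have -> : 2 `^ p / 2 * (`|x| `^ p + `|y| `^ p) =
    2 `^ p * (2^-1 * `|x| `^ p + 2^-1 * `|y| `^ p) by lra.
apply: le_trans (ler_wpM2l (powR_ge0 _ _) h).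
rewrite -powRM// ?addr_ge0 ?mulr_ge0//.
rewrite ge0_ler_powR ?nnegrE ?(ltW p0) ?mulr_ge0 ?addr_ge0 ?mulr_ge0//.
by have := ler_normD x y; lra.
Qed.

(** Write x^r as x times x^(r-1) and enlarge the second factor to (x+y)^(r-1). *)
Lemma powR_superadd r x y : 1 <= r -> 0 <= x -> 0 <= y ->
  x `^ r + y `^ r <= (x + y) `^ r.
Proof.
move=> r1 x0 y0; have r0 : 0 < r by rewrite (lt_le_trans ltr01).
have xy0 : 0 <= x + y by rewrite addr_ge0.
have rm1 : 0 <= r - 1 by rewrite subr_ge0.
rewrite -(mulr_powRB1 x0 r0) -(mulr_powRB1 y0 r0) -(mulr_powRB1 xy0 r0) mulrDl.
by rewrite lerD// ler_wpM2l// ge0_ler_powR ?nnegrE// ?lerDl ?lerDr.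
Qed.

(** Convexity of t^(p/2) at the squares of x + y and x - y, whose sum the parallelogram identity
    evaluates, followed by superadditivity of t^(p/2). *)
Lemma clarkson_powR p x y : 2 <= p ->
  `|x| `^ p + `|y| `^ p <= (`|x + y| `^ p + `|x - y| `^ p) / 2.
Proof.
move=> p2; have r1 : 1 <= p / 2 by rewrite ler_pdivlMr// mul1r.
have := powR_norm_midpoint ((x + y) ^+ 2) ((x - y) ^+ 2) r1.
have -> : (x + y) ^+ 2 + (x - y) ^+ 2 = 2 * (x ^+ 2 + y ^+ 2) by ring.
have s0 : 0 <= x ^+ 2 + y ^+ 2 by rewrite addr_ge0 ?sqr_ge0.
rewrite (ger0_norm (sqr_ge0 (x + y))) (ger0_norm (sqr_ge0 (x - y))).
rewrite (ger0_norm (mulr_ge0 (ler0n R 2) s0)) powRM ?addr_ge0 ?sqr_ge0//.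
rewrite -mulrA ler_pM2l ?powR_gt0//.
rewrite !powR_sqr_norm => h; rewrite mulrC; apply: le_trans h.
by rewrite -!(powR_sqr_norm _ p) powR_superadd ?sqr_ge0.
Qed.

(** Young's inequality for (1+x)^r and 1 with exponents 1/r and 1/(1-r). *)
Lemma bernoulli_powR r x : 0 < r < 1 -> 0 <= x -> (1 + x) `^ r <= 1 + r * x.
Proof.
move=> /andP[r0 r1] x0.
have := @conjugate_powR _ ((1 + x) `^ r) 1 r^-1 (1 - r)^-1.
rewrite !invrK mulr1 -powRrM mulfV ?gt_eqF// powRr1 ?addr_ge0// powR1.
move=> /(_ (powR_ge0 _ _) ler01); rewrite !invr_gt0 subr_gt0 => /(_ r0 r1).
rewrite addrC subrK => /(_ erefl); lra.
Qed.

(* Hoelder's inequality; the bound is attained at [t = x / (x + y)]. *)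
Lemma powR_concave_tangent r t x y : 0 < r < 1 -> 0 <= t <= 1 ->
  0 <= x -> 0 <= y ->
  t `^ (1 - r) * x `^ r + (1 - t) `^ (1 - r) * y `^ r <= (x + y) `^ r.
Proof.
move=> /andP[r0 r1] /andP[t0 t1] x0 y0.
have s0 : 0 < 1 - r by rewrite subr_gt0.
have t1' : 0 <= 1 - t by rewrite subr_ge0.
have := @hoelder2 _ (x `^ r) (y `^ r) (t `^ (1 - r)) ((1 - t) `^ (1 - r))
  r^-1 (1 - r)^-1 (powR_ge0 _ _) (powR_ge0 _ _) (powR_ge0 _ _) (powR_ge0 _ _).
rewrite !invr_gt0 !invrK => /(_ r0 s0); rewrite addrC subrK => /(_ erefl).
rewrite -!powRrM !mulfV ?gt_eqF// !powRr1//.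
rewrite (_ : t + (1 - t) = 1); last by lra.
by rewrite powR1 mulr1 mulrC (mulrC (y `^ r)).
Qed.

(** * The two-point inequality for 1 < p < 2 *)

Lemma ge0_derive_le (f df : R -> R) b : 0 <= b ->
  (forall x, 0 <= x <= b -> is_derive x 1 f (df x)) ->
  (forall x, 0 <= x <= b -> 0 <= df x) -> f 0 <= f b.
Proof.
move=> b0 fdf df0.
have D x : x \in `]0, b[%R -> is_derive x 1 f (df x).
  by rewrite in_itv => /andP[x0 xb]; apply: fdf; rewrite !ltW.
have C : {within `[0, b], continuous f}.
  apply: derivable_within_continuous => x; rewrite in_itv => xb.
  by have [] := fdf x xb.
have [c cb fE] := MVT_segment b0 D C.
rewrite -subr_ge0 fE mulr_ge0 ?subr0// df0//.
Qed.

Lemma is_derive_powR_affine (e a t : R) : 0 < 1 + e * t ->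
  is_derive t 1 (fun t => (1 + e * t) `^ a) (e * (a * (1 + e * t) `^ (a - 1))).
Proof.
move=> h.
have d1 : is_derive t 1 (fun t => 1 + e * t) e.
  have : is_derive t 1 (cst 1 + e \*: id) (0 + e *: 1).
    exact: is_deriveD.
  by rewrite add0r [e *: 1]mulr1.
have := @is_derive1_comp _ (@powR R ^~ a) (fun t => 1 + e * t) t _ _
  (is_derive1_powR a h) d1.
by rewrite mulrC.
Qed.

(** The derivative of the difference of the two sides is s (X + Y - 2) with X = (1+x)^(s-1) and Y =
    (1-x)^(s-1). Since X Y = (1-x^2)^(s-1) >= 1, the arithmetic-geometric mean inequality gives X +
    Y >= 2. *)
Lemma powR_diff_ge s b : 0 < s < 1 -> 0 <= b < 1 ->
  2 * s * b <= (1 + b) `^ s - (1 - b) `^ s.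
Proof.
move=> /andP[s0 s1] /andP[b0 b1].
pose f t := (1 + 1 * t) `^ s - (1 + (-1) * t) `^ s - 2 * s * t.
pose df t := 1 * (s * (1 + 1 * t) `^ (s - 1))
   - (-1) * (s * (1 + (-1) * t) `^ (s - 1)) - (2 * s) *: 1.
have : f 0 <= f b.
  apply: (@ge0_derive_le f df b b0) => x /andP[x0 xb].
    apply: is_deriveB; first by apply: is_deriveB; apply: is_derive_powR_affine; lra.
  rewrite /df; set X := _ `^ _; set Y := _ `^ _.
  have X0 : 0 < X by rewrite powR_gt0//; lra.
  have Y0 : 0 < Y by rewrite powR_gt0//; lra.
  have XY : 1 <= X * Y.
    rewrite /X /Y -powRM; [|lra..].
    have -> : s - 1 = - (1 - s) by lra.
    have z1 : 0 < (1 + 1 * x) * (1 + -1 * x) by apply: mulr_gt0; lra.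
    rewrite powRN invf_ge1 ?powR_gt0//.
    apply: (@le_trans _ _ (1 `^ (1 - s))); last by rewrite powR1.
    rewrite ge0_ler_powR ?nnegrE ?(ltW z1)//; [lra|nra].
  have : 2 <= X + Y.
    rewrite -(@ler_pXn2r _ 2) ?nnegrE ?addr_ge0 ?(ltW X0) ?(ltW Y0)//.
    by have := sqr_ge0 (X - Y); nra.
  rewrite [(2 * s) *: 1]mulr1; nra.
rewrite /f !mulr0 !addr0 subrr subr0 !mul1r mulN1r; lra.
Qed.

(** The derivative of the difference of the two sides is p times the difference in [powR_diff_ge]
    for s = p - 1. *)
Lemma two_point_taylor_lt p b : 1 < p < 2 -> 0 <= b < 1 ->
  2 + p * (p - 1) * b ^+ 2 <= (1 + b) `^ p + (1 - b) `^ p.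
Proof.
move=> /andP[p1 p2] /andP[b0 b1].
pose f t := (1 + 1 * t) `^ p + (1 + (-1) * t) `^ p - p * (p - 1) * t ^+ 2.
pose df t := 1 * (p * (1 + 1 * t) `^ (p - 1))
   + (-1) * (p * (1 + (-1) * t) `^ (p - 1))
   - (p * (p - 1)) *: ((2%:R * t ^+ 1) *: 1).
have : f 0 <= f b.
  apply: (@ge0_derive_le f df b b0) => x /andP[x0 xb].
    apply: is_deriveB; first by apply: is_deriveD; apply: is_derive_powR_affine; lra.
    have h : is_derive x 1 ((p * (p - 1)) \*: ((@id R) ^+ 2))
        ((p * (p - 1)) *: ((2%:R * x ^+ 1) *: 1)).
      by apply: is_deriveZ; exact: is_deriveX.
    exact: h.
  have : 2 * (p - 1) * x <= (1 + x) `^ (p - 1) - (1 - x) `^ (p - 1).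
    by apply: powR_diff_ge; apply/andP; split; lra.
  rewrite -subr_ge0 => h.
  have -> : df x = p * ((1 + x) `^ (p - 1) - (1 - x) `^ (p - 1) - 2 * (p - 1) * x).
    by rewrite /df mul1r mulN1r /GRing.scale/= !mul1r mulN1r; ring.
  by rewrite mulr_ge0//; lra.
rewrite /f !mulr0 !addr0 powR1 expr0n /= mulr0 !mul1r mulN1r; lra.
Qed.

Lemma two_point_taylor p b : 1 < p < 2 -> 0 <= b <= 1 ->
  2 + p * (p - 1) * b ^+ 2 <= (1 + b) `^ p + (1 - b) `^ p.
Proof.
move=> p12 /andP[b0]; rewrite le_eqVlt => /predU1P[->|b1]; last first.
  by apply: two_point_taylor_lt => //; rewrite b0.
have /andP[p1 p2] := p12.
rewrite subrr powR0 ?gt_eqF ?(lt_trans ltr01)// expr1n mulr1 addr0.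
(* The case b = 1 is approached from b = 1 - d. The quadratic term loses at most 4 d and d^p is at
   most d, which makes 5 d <= e in total. *)
apply/ler_addgt0Pl => e e0; pose d := Num.min (e / 5) 2^-1.
have d0 : 0 < d by rewrite lt_min divr_gt0//= invr_gt0.
have de : 5 * d <= e.
  by rewrite -ler_pdivlMl// mulrC ge_min lexx.
have d2 : d <= 2^-1 by rewrite ge_min lexx orbT.
have hb : 0 <= 1 - d < 1 by apply/andP; split; lra.
have := two_point_taylor_lt p12 hb.
have h1 : (1 + (1 - d)) `^ p <= (1 + 1) `^ p.
  by rewrite ge0_ler_powR ?nnegrE; lra.
have h2 : (1 - (1 - d)) `^ p <= d.
  have -> : 1 - (1 - d) = d by lra.
  by apply: ge1r_powR; [apply/andP; split; lra|lra].
have c2 : p * (p - 1) <= 2 by nra.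
have c0 : 0 <= p * (p - 1) by nra.
have : p * (p - 1) - 4 * d <= p * (p - 1) * (1 - d) ^+ 2.
  by move: c0 c2; set c := p * (p - 1) => c0 c2; nra.
lra.
Qed.

(** Scaling reduces to x = 1 and y = b. Bernoulli bounds the left side by 1 + p (p-1) b^2 / 2, which
    [two_point_taylor] bounds by the right side. *)
Lemma two_point_le p x y : 1 < p < 2 -> `|y| <= `|x| ->
  (x ^+ 2 + (p - 1) * y ^+ 2) `^ (p / 2) <=
  (`|x + y| `^ p + `|x - y| `^ p) / 2.
Proof.
move=> p12; have /andP[p1 p2] := p12.
have [->|x0] := eqVneq x 0.
  rewrite normr0 normr_le0 => /eqP ->.
  by rewrite expr0n/= mulr0 addr0 powR0 ?divr_ge0 ?addr_ge0 ?powR_ge0//; lra.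
move=> yx; pose b := y / x.
have nx : 0 < `|x| by rewrite normr_gt0.
have -> : y = b * x by rewrite /b divfK.
have {yx} : `|b| <= 1 by rewrite normrM normfV ler_pdivrMr// mul1r.
move: b => b b1.
have -> : x + b * x = (1 + b) * x by ring.
have -> : x - b * x = (1 - b) * x by ring.
have -> : x ^+ 2 + (p - 1) * (b * x) ^+ 2 = (1 + (p - 1) * b ^+ 2) * x ^+ 2 by ring.
have b20 : 0 <= (p - 1) * b ^+ 2 by rewrite mulr_ge0 ?sqr_ge0//; lra.
rewrite powRM ?sqr_ge0 ?addr_ge0// powR_sqr_norm !normrM !powRM//.
rewrite -mulrDl -mulrAC ler_pM2r ?powR_gt0//.
rewrite (@le_trans _ _ (1 + p / 2 * ((p - 1) * b ^+ 2)))//.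
  by apply: bernoulli_powR => //; apply/andP; split; lra.
have {b20} : 2 + p * (p - 1) * `|b| ^+ 2 <= (1 + `|b|) `^ p + (1 - `|b|) `^ p.
  by apply: two_point_taylor => //; rewrite normr_ge0.
rewrite real_normK ?num_real//.
have -> : `|1 + b| `^ p + `|1 - b| `^ p = (1 + `|b|) `^ p + (1 - `|b|) `^ p.
  move: b1; rewrite ler_norml => /andP[b1 b2].
  rewrite (@ger0_norm _ (1 + b)); last by lra.
  rewrite (@ger0_norm _ (1 - b)); last by lra.
  have [b0|b0] := leP 0 b; first by rewrite ger0_norm.
  by rewrite ltr0_norm// opprK addrC.
lra.
Qed.

(** If |x| < |y|, exchanging x and y enlarges the left side, as p - 1 < 1, and leaves the right side
    unchanged. *)
Lemma two_point p x y : 1 < p < 2 ->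
  (x ^+ 2 + (p - 1) * y ^+ 2) `^ (p / 2) <=
  (`|x + y| `^ p + `|x - y| `^ p) / 2.
Proof.
move=> p12; have /andP[p1 p2] := p12.
have [|xy] := leP `|y| `|x|; first exact: two_point_le.
have xy2 : x ^+ 2 <= y ^+ 2.
  by rewrite -(real_normK (num_real x)) -(real_normK (num_real y)) lerXn2r ?nnegrE// ltW.
rewrite (addrC x) -(normrN (x - y)) opprB.
apply: le_trans (two_point_le p12 (ltW xy)).
have x20 := sqr_ge0 x; have y20 := sqr_ge0 y.
have xp : 0 <= x ^+ 2 + (p - 1) * y ^+ 2.
  by apply: addr_ge0 => //; apply: mulr_ge0 => //; lra.
have yp : 0 <= y ^+ 2 + (p - 1) * x ^+ 2.
  by apply: addr_ge0 => //; apply: mulr_ge0 => //; lra.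
by rewrite ge0_ler_powR ?nnegrE//; [lra|nra].
Qed.

(** With x half of u - v and y the offset of a point c from the midpoint of u and v, x + y = u - c
    and x - y = c - v. The hypothesis is used for c = a and c = b, and convexity merges the two
    offsets into a - b. *)
Lemma four_point p A B : 1 <= p -> 0 <= A -> 0 <= B ->
  (forall x y, A * `|x| `^ p + B * `|y| `^ p <=
     (`|x + y| `^ p + `|x - y| `^ p) / 2) ->
  forall u v a b, A * `|u - v| `^ p + B * `|a - b| `^ p <=
    2 `^ p / 4 * (`|u - a| `^ p + `|a - v| `^ p +
                  (`|u - b| `^ p + `|b - v| `^ p)).
Proof.
move=> p1 A0 B0 AB u v a b.
pose x := (u - v) / 2; pose y c := (u + v) / 2 - c.
have key c : A * `|x| `^ p + B * `|y c| `^ p <=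
    (`|u - c| `^ p + `|c - v| `^ p) / 2.
  rewrite (_ : u - c = x + y c); last by rewrite /x /y; field.
  by rewrite (_ : c - v = x - y c); [exact: AB|rewrite /x /y; field].
have ha := key a; have hb := key b.
have := powR_norm_midpoint (y b) (- y a) p1.
rewrite (_ : y b - y a = a - b); last by rewrite /y; ring.
rewrite normrN => hy.
have -> : `|u - v| `^ p = 2 `^ p * `|x| `^ p.
  rewrite -[in RHS](@ger0_norm _ 2)// -powRM// -normrM; congr (`|_| `^ _).
  by rewrite /x; field.
have p0 : 0 < 2 `^ p :> R by rewrite powR_gt0.
have hB := ler_wpM2l B0 hy.
have := lerD ha hb; rewrite -(ler_pM2l p0) => h.
set X := _ `^ p in h hB *; set Ya := _ `^ p in h hB *.
nra.
Qed.

End power_inequalities.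

(** * Distances in Lp spaces *)

Section Lp_interface.
Context d (T : measurableType d) (R : realType).
Variables (mu : {measure set T -> \bar R}) (p : R) (p1 : (1 <= p%:E)%E).
Implicit Types f g : Lp_space mu p1.

Let p_gt0 : 0 < p. Proof. by apply: lt_le_trans ltr01 _; rewrite -lee_fin. Qed.

Lemma measurable_Lp_fun f : measurable_fun setT (Lp_fun f).
Proof.
exact: (@measurable_funPT _ _ _ _
  (repr ((f : LspaceType mu p1) : {mfun_ mu, T >-> measurableTypeR R}))).
Qed.

Lemma Lp_fun_Lfun f : Lp_fun f \in Lfun mu p%:E.
Proof.
rewrite inE /=; apply/andP; split; rewrite inE /=.
  exact: measurable_Lp_fun.
exact: (@Lebesgue_finite _ _ _ _ _ _ f).
Qed.

Lemma Lp_distE f g :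
  ((Lp_dist f g) `^ p)%:E = (\int[mu]_x (`|Lp_fun f x - Lp_fun g x| `^ p)%:E)%E.
Proof.
pose F h : LfunType mu p1 := Lfun_Sub p1 (Lp_fun_Lfun h).
rewrite -poweR_EFin /Lp_dist -[X in fine X]/('N[mu]_p%:E[EFin \o (F f - F g)%R]%E).
by rewrite finite_norm_fine poweR_Lnorm ?gt_eqF.
Qed.

Lemma measurable_powR_norm (phi : T -> R) : measurable_fun setT phi ->
  measurable_fun setT (fun x => (`|phi x| `^ p)%:E).
Proof.
move=> mphi; apply/measurable_EFinP.
apply: (@measurableT_comp _ _ _ _ _ _ (@powR R ^~ p)) => //.
exact: measurableT_comp.
Qed.

Lemma Lp_class (phi : T -> R) : measurable_fun setT phi ->
  (\int[mu]_x (`|phi x| `^ p)%:E < +oo)%E ->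
  exists f, ae_eq mu setT (Lp_fun f) phi.
Proof.
move=> mphi fphi.
pose m : {mfun T >-> measurableTypeR R} :=
  HB.pack phi (@isMeasurableFun.Build _ _ _ (measurableTypeR R) phi mphi).
pose q : {mfun_ mu, T >-> measurableTypeR R} :=
  \pi_{mfun_ mu, T >-> measurableTypeR R}%qT m.
have qm : ae_eq mu setT (q : T -> R) phi.
  have /eqmodP/asboolP h :
      (repr q = m %[mod {mfun_ mu, T >-> measurableTypeR R}])%qT.
    by rewrite reprK.
  by apply: filterS h => x /(_ I).
have mq : measurable_fun setT (q : T -> R).
  exact: (@measurable_funPT _ _ _ _ (repr q)).
have fq : finite_norm mu p%:E (q : T -> R).
  rewrite /finite_norm unlock; apply: poweR_lty.
  rewrite (ae_eq_integral (fun x => (`|phi x| `^ p)%:E)) //.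
  - exact: measurable_powR_norm.
  - exact: measurable_powR_norm.
  - by apply: filterS qm => x qx _; rewrite -(qx I).
pose f : LspaceType mu p1 := HB.pack q (isFinLebesgue.Build _ _ _ mu p%:E p1 q fq).
by exists f.
Qed.

Lemma Lp_dist_class f g (phi psi : T -> R) :
  ae_eq mu setT (Lp_fun f) phi -> ae_eq mu setT (Lp_fun g) psi ->
  measurable_fun setT phi -> measurable_fun setT psi ->
  ((Lp_dist f g) `^ p)%:E = (\int[mu]_x (`|phi x - psi x| `^ p)%:E)%E.
Proof.
move=> fphi gpsi mphi mpsi; rewrite Lp_distE; apply: ae_eq_integral => //.
- exact/measurable_powR_norm/measurable_funB/measurable_Lp_fun/measurable_Lp_fun.
- exact/measurable_powR_norm/measurable_funB.
- by apply: filterS2 fphi gpsi => x fx gx _; rewrite (fx I) (gx I).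
Qed.

(** All terms are p-th powers of distances, so the scalar inequality can be integrated pointwise. *)
Lemma four_point_transfer (A B : R) : 0 <= A -> 0 <= B ->
  (forall u v a b : R, A * `|u - v| `^ p + B * `|a - b| `^ p <=
     `|u - a| `^ p + `|a - v| `^ p + (`|u - b| `^ p + `|b - v| `^ p)) ->
  forall u v a b : Lp_space mu p1,
  A * Lp_dist u v `^ p + B * Lp_dist a b `^ p <=
  Lp_dist u a `^ p + Lp_dist a v `^ p + (Lp_dist u b `^ p + Lp_dist b v `^ p).
Proof.
move=> A0 B0 H u v a b; rewrite -lee_fin !(EFinD, EFinM) !Lp_distE.
have M f g : measurable_fun setT (fun x => (`|Lp_fun f x - Lp_fun g x| `^ p)%:E).
  exact/measurable_powR_norm/measurable_funB/measurable_Lp_fun/measurable_Lp_fun.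
have P (x : R) y : (0 <= (x `^ y)%:E)%E by rewrite lee_fin powR_ge0.
rewrite -!ge0_integralZl ?lee_fin// -!ge0_integralD//; do ?
  [by move=> x _; rewrite ?adde_ge0 ?mule_ge0 ?lee_fin ?powR_ge0
  |exact: emeasurable_funD|exact: measurable_funeM].
apply: ge0_le_integral => //; do ?
  [by move=> x _; rewrite ?adde_ge0 ?mule_ge0 ?lee_fin ?powR_ge0
  |by apply: emeasurable_funD; apply: measurable_funeM
  |by apply: emeasurable_funD; apply: emeasurable_funD].
Qed.

End Lp_interface.

(** * Lower bounds *)

Section pigeonhole.
Variable R : realType.

(** The range of each coordinate is cut into cells of length [eta]. There are finitely many patterns
    of cells for N coordinates, so among one point more than patterns two share a pattern. *)
Lemma pigeonhole_close (N : nat) (a : nat -> nat -> R) (B eta : R) : 0 < eta ->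
  (forall i n, (n < N)%N -> `|a i n| <= B) ->
  exists i j, i <> j /\ forall n, (n < N)%N -> `|a i n - a j n| <= eta.
Proof.
move=> eta0 aB; pose M := Num.truncn ((B + B) / eta).
pose c i : {ffun 'I_N -> 'I_M.+1} :=
  [ffun n : 'I_N => inord (Num.truncn ((a i n + B) / eta))].
have [/injectiveP cinj|] :=
    boolP (injectiveb (fun i : 'I_(#|{ffun 'I_N -> 'I_M.+1}|.+1) => c i)).
  have := max_card (mem (codom (fun i : 'I_(#|{ffun 'I_N -> 'I_M.+1}|.+1) => c i))).
  by rewrite card_codom// card_ord ltnn.
move=> /injectivePn[i [j ij cij]]; exists i, j; split.
  by move=> h; move/eqP: ij; apply; exact: val_inj.
move=> n nN; have /ffunP/(_ (Ordinal nN)) := cij; rewrite !ffunE/=.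
have H l : 0 <= (a l n + B) / eta /\
    (Num.truncn ((a l n + B) / eta) < M.+1)%N.
  have := aB l n nN; rewrite ler_norml => /andP[h1 h2]; split.
    by rewrite divr_ge0 ?(ltW eta0)//; lra.
  by rewrite ltnS le_truncn// ler_pM2r ?invr_gt0//; lra.
have [hi1 hi2] := H i; have [hj1 hj2] := H j.
move=> /(congr1 val); rewrite /= !inordK// => E.
have /andP[hi3 hi4] := truncn_itv hi1; have /andP[hj3 hj4] := truncn_itv hj1.
rewrite E in hi3 hi4; move: hi3 hi4 hj3 hj4.
set m := Num.truncn _; rewrite -natr1 => hi3 hi4 hj3 hj4.
have : `|(a i n + B) / eta - (a j n + B) / eta| <= 1.
  by rewrite ler_norml; apply/andP; split; lra.
rewrite -mulrBl normrM normfV (gtr0_norm eta0) ler_pdivrMr// mul1r.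
by rewrite opprD addrACA subrr addr0.
Qed.

End pigeonhole.

Section four_points.
Variable R : realType.
Implicit Types p q : R.

(** The left side is the average of the p-th powers of the four doubled numbers. *)
Lemma four_le_max p (a b c d : R) : 0 <= p ->
  0 <= a -> 0 <= b -> 0 <= c -> 0 <= d ->
  2 `^ p / 4 * (a `^ p + b `^ p + (c `^ p + d `^ p)) <=
  Num.max (Num.max (2 * a) (2 * b)) (Num.max (2 * c) (2 * d)) `^ p.
Proof.
move=> p0 a0 b0 c0 d0; set M := Num.max _ _.
have M0 : 0 <= M by rewrite !le_max mulr_ge0.
have key x : 0 <= x -> 2 * x <= M -> 2 `^ p * x `^ p <= M `^ p.
  by move=> x0 xM; rewrite -powRM// ge0_ler_powR ?nnegrE// mulr_ge0.
have ha : 2 `^ p * a `^ p <= M `^ p by apply: key; rewrite // !le_max lexx.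
have hb : 2 `^ p * b `^ p <= M `^ p by apply: key; rewrite // !le_max lexx ?orbT.
have hc : 2 `^ p * c `^ p <= M `^ p by apply: key; rewrite // !le_max lexx ?orbT.
have hd : 2 `^ p * d `^ p <= M `^ p by apply: key; rewrite // !le_max lexx ?orbT.
lra.
Qed.

Lemma max_index (T : Type) (f : T -> R) (a b : T) :
  exists2 i, i = a \/ i = b & Num.max (f a) (f b) = f i.
Proof.
by have [h|h] := leP (f a) (f b); [exists b; [right|]|exists a; [left|]].
Qed.

Context d (T : measurableType d) (mu : {measure set T -> \bar R}).

Lemma Lp_four_point p (p1 : (1 <= p%:E)%E) (A B : R) : 0 <= A -> 0 <= B ->
  (forall x y : R, A * `|x| `^ p + B * `|y| `^ p <=
     (`|x + y| `^ p + `|x - y| `^ p) / 2) ->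
  forall u v a b : Lp_space mu p1,
  A * mdist u v `^ p + B * mdist a b `^ p <=
  Num.max (Num.max (2 * mdist u a) (2 * mdist a v))
          (Num.max (2 * mdist u b) (2 * mdist b v)) `^ p.
Proof.
move=> A0 B0 AB u v a b; have p1' : 1 <= p by rewrite -lee_fin.
apply: le_trans (four_le_max _ _ _ _ _); rewrite ?mdist_ge0 ?(le_trans ler01)//.
have k0 : 0 < 2 `^ p / 4 :> R by rewrite divr_gt0 ?powR_gt0.
have := @four_point_transfer _ _ _ mu p p1 (A / (2 `^ p / 4)) (B / (2 `^ p / 4)).
have ? : 0 <= A / (2 `^ p / 4) by rewrite divr_ge0// ltW.
have ? : 0 <= B / (2 `^ p / 4) by rewrite divr_ge0// ltW.
move=> /(_ _ _ _ u v a b) => H.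
rewrite -ler_pdivrMl// mulrDr !mulrA ![_^-1 * _]mulrC.
apply: H => // {}u {}v {}a {}b.
rewrite ![_ / (2 `^ p / 4)]mulrC -!mulrA -mulrDr ler_pdivrMl//.
exact: four_point.
Qed.

Lemma convex_midpoints_Lp_ge2 p (p1 : (1 <= p%:E)%E) : 2 <= p ->
  convex_midpoints (Lp_space mu p1 : metricType R) p 1.
Proof.
move=> p2 u v a dl dl0 adl.
have p0 : 0 <= p by rewrite (le_trans _ p2).
pose f i := Num.max (2 * mdist u (a i)) (2 * mdist (a i) v).
have [i _ Hi] := max_index f 0%N 1%N.
exists i; rewrite -/(f i) -Hi mul1r.
have := @Lp_four_point p p1 1 1 ler01 ler01 _ u v (a 0%N) (a 1%N).
rewrite !mul1r => H; apply: le_trans (H _); last first.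
  by move=> x y; rewrite !mul1r; exact: clarkson_powR.
by rewrite lerD2l ge0_ler_powR ?nnegrE ?mdist_ge0 ?(ltW dl0) ?adl.
Qed.

(** The left side of the two-point inequality is a concave power r = p/2 of a sum, which does not
    integrate term by term. It is first replaced by a smaller expression linear in p-th powers,
    through [powR_concave_tangent] with a fixed t. *)
Lemma convex_midpoints_Lp_lt2 p (p1 : (1 <= p%:E)%E) : 1 < p < 2 ->
  convex_midpoints (Lp_space mu p1 : metricType R) 2 (p - 1).
Proof.
move=> p12 u v a dl dl0 adl; have /andP[p1' p2] := p12.
pose f i := Num.max (2 * mdist u (a i)) (2 * mdist (a i) v).
have [i _ Hi] := max_index f 0%N 1%N.
exists i; rewrite -/(f i) -Hi.
have f0 j : 0 <= f j by rewrite /f le_max mulr_ge0 ?mdist_ge0.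
have M0 : 0 <= Num.max (f 0%N) (f 1%N) by rewrite le_max f0.
set M := Num.max _ _ in M0 *; pose r := p / 2.
have r01 : 0 < r < 1 by apply/andP; rewrite /r; split; lra.
have /andP[r0 r1] := r01.
have c0 : 0 < p - 1 by lra.
rewrite !powR_mulrn ?mdist_ge0 ?(ltW dl0)//.
set X := mdist u v ^+ 2; set Y := (p - 1) * dl ^+ 2.
have X0 : 0 <= X by rewrite exprn_ge0 ?mdist_ge0.
have Y0 : 0 < Y by rewrite mulr_gt0 ?exprn_gt0.
have s0 : 0 < X + Y by lra.
(* This t makes the tangent bound an equality at X and Y, so nothing is lost after integration. *)
pose t := X / (X + Y).
have t0 : 0 <= t by rewrite divr_ge0 ?(ltW s0).
have t1 : 1 - t = Y / (X + Y) by rewrite /t; field; rewrite gt_eqF.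
have t1' : t <= 1 by rewrite -subr_ge0 t1 divr_ge0// ltW.
pose A := t `^ (1 - r); pose B := (1 - t) `^ (1 - r) * (p - 1) `^ r.
have A0 : 0 <= A by exact: powR_ge0.
have B0 : 0 <= B by rewrite mulr_ge0 ?powR_ge0.
have AB (x y : R) : A * `|x| `^ p + B * `|y| `^ p <=
     (`|x + y| `^ p + `|x - y| `^ p) / 2.
  apply: le_trans (two_point _ _ p12); rewrite -!(powR_sqr_norm _ p) -/r.
  rewrite /B -mulrA -powRM ?(ltW c0) ?sqr_ge0//.
  apply: powR_concave_tangent => //; rewrite ?sqr_ge0 ?t0//.
  by rewrite mulr_ge0 ?sqr_ge0// ltW.
have {AB} := Lp_four_point A0 B0 AB u v (a 0%N) (a 1%N).
rewrite -/(f 0%N) -/(f 1%N) -/M => H.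
(* Added for Z = X and Z = Y, the right sides give (X + Y)^r. *)
have E Z : 0 <= Z -> (Z / (X + Y)) `^ (1 - r) * Z `^ r =
    Z * (X + Y) `^ (r - 1).
  move=> Z0; rewrite powRM ?invr_ge0 ?(ltW s0)// mulrAC -powRD; last first.
    by rewrite subrK oner_eq0.
  rewrite subrK powRr1// -(powR_inv1 (ltW s0)) -powRrM; congr (_ * _ `^ _); ring.
have sM : (X + Y) `^ r <= M `^ p.
  apply: le_trans H.
  have -> : mdist u v `^ p = X `^ r.
    by rewrite /X powR_sqr_norm ger0_norm ?mdist_ge0.
  rewrite (@le_trans _ _ (A * X `^ r + B * dl `^ p))//; last first.
    rewrite lerD2l ler_wpM2l// ge0_ler_powR ?nnegrE ?mdist_ge0 ?(ltW dl0) ?adl//.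
    by lra.
  have -> : B * dl `^ p = (1 - t) `^ (1 - r) * Y `^ r.
    rewrite /B -mulrA /Y powRM ?(ltW c0) ?sqr_ge0// powR_sqr_norm.
    by rewrite (gtr0_norm dl0).
  rewrite /A t1 !E ?(ltW Y0)// -mulrDl mulr_powRB1 ?(ltW s0)//.
have q0 : 0 <= 2 / p by rewrite divr_ge0//; lra.
have : ((X + Y) `^ r) `^ (2 / p) <= (M `^ p) `^ (2 / p).
  by rewrite ge0_ler_powR ?nnegrE ?powR_ge0.
rewrite -!powRrM.
have -> : r * (2 / p) = 1 by rewrite /r; field; rewrite gt_eqF//; lra.
have -> : p * (2 / p) = 2 by field; rewrite gt_eqF//; lra.
by rewrite powRr1 ?(ltW s0)// powR_mulrn.
Qed.

End four_points.

(** * Midpoints in l_p, including p = 1 *)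

Section lp_midpoints.
Variables (R : realType) (p : R) (p1 : (1 <= p%:E)%E).
Implicit Types u v : lp p1.

Let p_ge1 : 1 <= p. Proof. by rewrite -lee_fin. Qed.

Let p_gt0 : 0 < p. Proof. exact: lt_le_trans ltr01 p_ge1. Qed.

Definition lp_sum u v N : R := \sum_(i < N) `|Lp_fun u i - Lp_fun v i| `^ p.

Let term_ge0 u v i : (0 <= (`|Lp_fun u i - Lp_fun v i| `^ p)%:E)%E.
Proof. by rewrite lee_fin powR_ge0. Qed.

Lemma lp_mdistE u v : (mdist u v `^ p)%:E =
  (\sum_(i <oo) (`|Lp_fun u i - Lp_fun v i| `^ p)%:E)%E.
Proof. by rewrite -ge0_integral_count//; exact: Lp_distE. Qed.

Lemma lp_sum_le u v N : lp_sum u v N <= mdist u v `^ p.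
Proof.
rewrite -lee_fin lp_mdistE /lp_sum -sumEFin -(big_mkord xpredT
  (fun i => (`|Lp_fun u i - Lp_fun v i| `^ p)%:E)).
by apply: nneseries_lim_ge => n _ _; exact: term_ge0.
Qed.

Lemma lp_sum_mono u v N M : (N <= M)%N -> lp_sum u v N <= lp_sum u v M.
Proof.
move=> NM; rewrite /lp_sum.
rewrite -!(big_mkord xpredT (fun i => `|Lp_fun u i - Lp_fun v i| `^ p)).
by rewrite [leRHS](big_cat_nat (n := N))//= lerDl sumr_ge0// => i _; exact: powR_ge0.
Qed.

Lemma lp_sum_ge u v e : 0 < e -> exists N, mdist u v `^ p - e <= lp_sum u v N.
Proof.
move=> e0; apply: contrapT => /forallNP H.
suff : mdist u v `^ p <= mdist u v `^ p - e by lra.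
rewrite -lee_fin lp_mdistE; apply: lime_le.
  by apply: is_cvg_nneseries => n _ _; exact: term_ge0.
apply: nearW => N; rewrite big_mkord sumEFin lee_fin.
by rewrite leNgt; apply/negP => /ltW; exact: H.
Qed.

Lemma lp_coord_le u v n : `|Lp_fun u n - Lp_fun v n| <= mdist u v.
Proof.
apply: (powR_le_inv p_gt0); rewrite ?mdist_ge0//.
apply: le_trans (lp_sum_le u v n.+1); rewrite /lp_sum big_ord_recr/= lerDr.
by rewrite sumr_ge0// => i _; exact: powR_ge0.
Qed.

(* On the first [N] coordinates [a] and [b] almost coincide and are midpoints
   of [u] and [v]; on the others [u] and [v] are midpoints of [a] and [b]. *)
Lemma lp_four_point u v (a b : lp p1) N M : (N <= M)%N ->
  lp_sum u v N + (lp_sum a b M - lp_sum a b N) <=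
  2 `^ p / 4 * (lp_sum u a M + lp_sum a v M + (lp_sum u b M + lp_sum b v M)).
Proof.
move=> NM; rewrite /lp_sum.
do ![rewrite -(big_mkord xpredT (fun i => `|Lp_fun _ i - Lp_fun _ i| `^ p))].
rewrite (big_cat_nat (n := N) (p := M)
  (F := fun i => `|Lp_fun a i - Lp_fun b i| `^ p))//=.
rewrite [X in _ + (X - _)]addrC addrK -!big_split/= mulr_sumr.
rewrite [leRHS](big_cat_nat (n := N))//=.
have C0 : 0 <= 2 `^ p / 4 :> R by rewrite divr_ge0 ?powR_ge0.
(* Convexity alone gives the hypothesis of [four_point] with weights (1, 0), used below [N]; by
   symmetry it also gives the weights (0, 1), used from [N] on. *)
have AB01 : forall x y : R, 1 * `|x| `^ p + 0 * `|y| `^ p <=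
     (`|x + y| `^ p + `|x - y| `^ p) / 2.
  move=> x y; rewrite mul1r mul0r addr0.
  have := powR_norm_midpoint ((x + y) / 2) ((x - y) / 2) p_ge1.
  rewrite (_ : _ / 2 + _ = x); last by field.
  rewrite !normrM !powRM// !(@ger0_norm _ 2^-1)// -mulrDl mulrC -mulrA.
  rewrite (_ : 2^-1 `^ p * (2 `^ p / 2) = 2^-1)//.
  by rewrite mulrA -powRM// mulVf ?powR1 ?mul1r ?pnatr_eq0.
have AB10 : forall x y : R, 0 * `|x| `^ p + 1 * `|y| `^ p <=
     (`|x + y| `^ p + `|x - y| `^ p) / 2.
  by move=> x y; rewrite addrC (addrC x) -(normrN (x - y)) opprB; exact: AB01.
apply: lerD; apply: ler_sum => i _.
  have := four_point p_ge1 ler01 (lexx 0) AB01 (Lp_fun u i) (Lp_fun v i)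
    (Lp_fun a i) (Lp_fun b i).
  by rewrite mul1r mul0r addr0.
have := four_point p_ge1 (lexx 0) ler01 AB10 (Lp_fun u i) (Lp_fun v i)
  (Lp_fun a i) (Lp_fun b i).
by rewrite mul1r mul0r add0r.
Qed.

(** Cutting the series of d(u,v)^p, the contribution of the first N coordinates to d(a_i,a_j)^p, and
    cutting the series of the latter each cost at most dl^p / 8. The remaining gain of 5/8 dl^p
    exceeds the 1/2 assumed to be out of reach. *)
Lemma convex_midpoints_lp : convex_midpoints (lp p1) p 2^-1.
Proof.
move=> u v a dl dl0 adl.
pose f i := Num.max (2 * mdist u (a i)) (2 * mdist (a i) v).
apply: contrapT => /forallNP H.
have {}H i : f i `^ p < mdist u v `^ p + 2^-1 * dl `^ p.
  by rewrite ltNge; apply/negP; exact: H.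
have f0 j : 0 <= f j by rewrite /f le_max mulr_ge0 ?mdist_ge0.
pose K := (mdist u v `^ p + 2^-1 * dl `^ p) `^ p^-1.
have dp0 : 0 < dl `^ p by rewrite powR_gt0.
have fK i : f i <= K.
  have : (f i `^ p) `^ p^-1 <= K.
    rewrite ge0_ler_powR ?nnegrE ?powR_ge0 ?invr_ge0 ?(ltW p_gt0) ?(ltW (H i))//.
    by rewrite addr_ge0 ?mulr_ge0 ?powR_ge0.
  by rewrite -powRrM mulfV ?gt_eqF// powRr1.
have e0 : 0 < dl `^ p / 8 by rewrite divr_gt0.
have [N HN] := lp_sum_ge u v e0.
(* Chosen so that N coordinates within [eta] contribute at most dl^p / 8; the successor keeps the
   divisor nonzero when N = 0. *)
pose eta := ((dl `^ p / 8) / N.+1%:R) `^ p^-1.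
have eta0 : 0 < eta by rewrite powR_gt0// divr_gt0.
(* By contradiction all a_i stay within K of u, so their first N coordinates are bounded and the
   pigeonhole applies. *)
have bd i n : (n < N)%N ->
    `|Lp_fun (a i) n| <= K + `|\big[Num.max/0]_(j < N) `|Lp_fun u j| |.
  move=> nN; have h1 := lp_coord_le u (a i) n.
  have h2 : 2 * mdist u (a i) <= K by rewrite (le_trans _ (fK i))// le_max lexx.
  have h3 : `|Lp_fun u n| <= \big[Num.max/0]_(j < N) `|Lp_fun u j|.
    by have := le_bigmax 0 (fun j : 'I_N => `|Lp_fun u j|) (Ordinal nN).
  have h4 := ler_norm (\big[Num.max/0]_(j < N) `|Lp_fun u j|).
  have h5 := mdist_ge0 u (a i).
  have := ler_normB (Lp_fun u n) (Lp_fun u n - Lp_fun (a i) n).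
  by rewrite opprB addrCA subrr addr0; lra.
have [i [j [ij close]]] := pigeonhole_close eta0 bd.
have aN : lp_sum (a i) (a j) N <= dl `^ p / 8.
  apply: (@le_trans _ _ (\sum_(l < N) (dl `^ p / 8) / N.+1%:R)).
    apply: ler_sum => l _.
    have : `|Lp_fun (a i) l - Lp_fun (a j) l| `^ p <= eta `^ p.
      by rewrite ge0_ler_powR ?nnegrE ?(ltW p_gt0) ?(ltW eta0)// close.
    by rewrite /eta -powRrM mulVf ?gt_eqF// powRr1// divr_ge0// ltW.
  rewrite sumr_const card_ord -[leLHS]mulr_natr -mulrA ler_piMr ?(ltW e0)//.
  by rewrite ler_pdivrMl// mulr1 ler_nat.
have [M0 HM0] := lp_sum_ge (a i) (a j) e0.
pose M := maxn N M0.
have HM : mdist (a i) (a j) `^ p - dl `^ p / 8 <= lp_sum (a i) (a j) M.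
  by apply: le_trans HM0 _; apply: lp_sum_mono; rewrite leq_maxr.
have := lp_four_point u v (a i) (a j) (leq_maxl N M0); rewrite -/M => h4.
have hd : dl `^ p <= mdist (a i) (a j) `^ p.
  by rewrite ge0_ler_powR ?nnegrE ?mdist_ge0 ?(ltW p_gt0) ?(ltW dl0) ?adl.
have := four_le_max (ltW p_gt0) (mdist_ge0 u (a i)) (mdist_ge0 (a i) v)
  (mdist_ge0 u (a j)) (mdist_ge0 (a j) v).
rewrite -/(f i) -/(f j) => h5.
have h6 : Num.max (f i) (f j) `^ p < mdist u v `^ p + 2^-1 * dl `^ p.
  by have [_|_] := leP (f i) (f j).
have C0 : 0 <= 2 `^ p / 4 :> R by rewrite divr_ge0 ?powR_ge0.
have h7 : 2 `^ p / 4 * (lp_sum u (a i) M + lp_sum (a i) v M +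
      (lp_sum u (a j) M + lp_sum (a j) v M)) <=
    2 `^ p / 4 * (mdist u (a i) `^ p + mdist (a i) v `^ p +
      (mdist u (a j) `^ p + mdist (a j) v `^ p)).
  by apply: ler_wpM2l => //; apply: lerD; apply: lerD; exact: lp_sum_le.
move: (le_trans (le_trans h4 h7) (le_trans h5 (ltW h6))) HN HM aN hd dp0.
by clear; lra.
Qed.

End lp_midpoints.

(** * Upper bounds *)

Section linear_combinations.
Variables (R : realType) (T : Type) (phi : nat -> T -> R).

Definition lincomb (P : {poly R}) (x : T) : R := \sum_(i < size P) P`_i * phi i x.

Lemma lincombE (P : {poly R}) N x : (size P <= N)%N ->
  lincomb P x = \sum_(i < N) P`_i * phi i x.
Proof.
move=> PN; rewrite /lincomb (big_ord_widen _ (fun i => P`_i * phi i x) PN).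
rewrite [RHS](bigID (fun i : 'I_N => (i < size P)%N))/= [X in _ + X]big1 ?addr0//.
by move=> i; rewrite -leqNgt => Pi; rewrite nth_default ?mul0r.
Qed.

Lemma lincombB (P Q : {poly R}) x : lincomb P x - lincomb Q x = lincomb (P - Q) x.
Proof.
have hP := leq_maxl (size P) (size Q); have hQ := leq_maxr (size P) (size Q).
have hB : (size (P - Q)%R <= maxn (size P) (size Q))%N.
  by rewrite (leq_trans (size_polyD _ _))// size_polyN.
rewrite (lincombE _ hP) (lincombE _ hQ) (lincombE _ hB) -sumrB.
by apply: eq_bigr => i _; rewrite coefB mulrBl.
Qed.

End linear_combinations.

Lemma sum_mem_le (N : nat) (s : seq nat) :
  (\sum_(i < N) (nat_of_ord i \in s) <= size s)%N.
Proof.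
rewrite -(big_mkord xpredT (fun i => nat_of_bool (i \in s))).
rewrite -big_mkcond/= sum1_count -size_filter.
apply: uniq_leq_size; first by rewrite filter_uniq// iota_uniq.
by move=> i; rewrite mem_filter => /andP[].
Qed.

Lemma sum_powR_le (R : realType) (q : R) (P : {poly R}) (s : seq nat) N :
  0 < q -> (forall n, `|P`_n| <= 1) -> (forall n, n \notin s -> P`_n = 0) ->
  \sum_(i < N) `|P`_i| `^ q <= (size s)%:R.
Proof.
move=> q0 P1 Ps.
apply: (@le_trans _ _ (\sum_(i < N) (nat_of_ord i \in s))%:R); last first.
  by rewrite ler_nat sum_mem_le.
rewrite natr_sum; apply: ler_sum => i _.
have [iN|/Ps ->] := boolP (nat_of_ord i \in s); last by rewrite normr0 powR0 ?gt_eqF.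
apply: (@le_trans _ _ (1 `^ q)); last by rewrite powR1.
by rewrite ge0_ler_powR ?nnegrE ?(ltW q0).
Qed.

Section systems.
Context d (T : measurableType d) (R : realType).
Variables (mu : {measure set T -> \bar R}) (p : R) (p1 : (1 <= p%:E)%E).

Let p_gt0 : 0 < p. Proof. by apply: lt_le_trans ltr01 _; rewrite -lee_fin. Qed.

(** A class is chosen separately for each combination; distances follow because [lincomb] respects
    subtraction pointwise. *)
Lemma Lp_system (phi : nat -> T -> R) :
  (forall n, measurable_fun setT (phi n)) ->
  (forall P, (\int[mu]_x (`|lincomb phi P x| `^ p)%:E < +oo)%E) ->
  exists F : {poly R} -> Lp_space mu p1, forall P Q,
    ((mdist (F P) (F Q)) `^ p)%:E =
      (\int[mu]_x (`|lincomb phi (P - Q) x| `^ p)%:E)%E.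
Proof.
move=> mphi fin.
have mlin P : measurable_fun setT (lincomb phi P).
  by apply: measurable_sum => i; exact: measurable_funM.
have /choice[F HF] P := Lp_class p1 (mlin P) (fin P).
exists F => P Q; rewrite (Lp_dist_class (HF P) (HF Q) (mlin P) (mlin Q)).
by apply: eq_integral => x _; rewrite lincombB.
Qed.

Section disjoint_system.
Variables (A : nat -> set T) (w : nat -> R).
Hypotheses (mA : forall n, measurable (A n)) (tA : trivIset setT A)
  (w0 : forall n, 0 < w n) (muA : forall n, mu (A n) = (w n)%:E).

(** The indicator of [A n] scaled to norm one in L_p. *)
Let phi n x : R := w n `^ (- p^-1) * \1_(A n) x.

(** At each point at most one summand is nonzero, so the p-th power passes through the sum. *)
Lemma norm_lincomb_disjoint (P : {poly R}) x : `|lincomb phi P x| `^ p =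
  \sum_(i < size P) `|P`_i| `^ p * (w i)^-1 * \1_(A i) x.
Proof.
have [[n Anx]|nA] := pselect (exists n, A n x); last first.
  have z n : \1_(A n) x = 0 :> R by rewrite indicE memNset// => Anx; apply: nA; exists n.
  rewrite /lincomb !big1 ?normr0 ?powR0 ?gt_eqF// => i _; first by rewrite z mulr0.
  by rewrite /phi z !mulr0.
have z m : m != n -> \1_(A m) x = 0 :> R.
  move=> mn; rewrite indicE memNset// => Amx; move/eqP: mn; apply.
  by apply: (tA I I); exists x.
have o : \1_(A n) x = 1 :> R by rewrite indicE mem_set.
have [nP|Pn] := ltnP n (size P); last first.
  rewrite /lincomb !big1 ?normr0 ?powR0 ?gt_eqF// => i _.
    by rewrite z ?mulr0// ltn_eqF// (leq_trans _ Pn).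
  by rewrite /phi z ?mulr0// ltn_eqF// (leq_trans _ Pn).
rewrite /lincomb [in LHS](bigD1 (Ordinal nP))//= [in RHS](bigD1 (Ordinal nP))//=.
rewrite !big1 ?addr0; last 2 first.
- by move=> i /eqP iN; rewrite z ?mulr0//; apply/eqP => h; apply: iN; exact: val_inj.
- by move=> i /eqP iN; rewrite /phi z ?mulr0//; apply/eqP => h; apply: iN; exact: val_inj.
rewrite /phi o !mulr1 normrM powRM// (ger0_norm (powR_ge0 _ _)) -powRrM.
by rewrite mulNr mulVf ?gt_eqF// powR_inv1 ?(ltW (w0 n)).
Qed.

Lemma integral_lincomb_disjoint (P : {poly R}) :
  (\int[mu]_x (`|lincomb phi P x| `^ p)%:E)%E =
  (\sum_(i < size P) `|P`_i| `^ p)%:E.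
Proof.
under eq_integral do rewrite norm_lincomb_disjoint -sumEFin.
have c0 (i : 'I_(size P)) : 0 <= `|P`_i| `^ p * (w i)^-1.
  by rewrite mulr_ge0 ?powR_ge0// invr_ge0 ltW.
rewrite ge0_integral_sum//; last 2 first.
- move=> i; apply/measurable_EFinP; apply: measurable_funM => //.
- by move=> i x _; rewrite lee_fin mulr_ge0.
rewrite -sumEFin; apply: eq_bigr => i _.
under eq_integral do rewrite EFinM.
rewrite ge0_integralZl//; last 2 first.
- exact/measurable_EFinP.
- by rewrite lee_fin.
by rewrite integral_indic// setIT muA -EFinM divfK ?gt_eqF.
Qed.

Lemma distortion_disjoint_system k : (0 < k)%N ->
  (distortion (diamond R k) (Lp_space mu p1 : metricType R) <=
    (6 * k%:R `^ p^-1)%:E)%E.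
Proof.
move=> k0; have [n|P|F HF] := @Lp_system phi.
- exact: measurable_funM.
- by rewrite integral_lincomb_disjoint ltry.
have {}HF P Q : mdist (F P) (F Q) `^ p =
    \sum_(i < size (P - Q)%R) `|(P - Q)%R`_i| `^ p.
  by apply: EFin_inj; rewrite HF integral_lincomb_disjoint.
have pge1 : 1 <= p by rewrite -lee_fin.
have := @distortion_diamond_le R k (Lp_space mu p1) F 1 1 p k0 ltr01 (lexx _) pge1.
rewrite divr1 mulr1; apply.
- move=> P Q n; rewrite mul1r -coefB; apply: (powR_le_inv p_gt0); rewrite ?mdist_ge0// HF.
  have [nP|Pn] := ltnP n (size (P - Q)%R); last first.
    by rewrite nth_default// normr0 powR0 ?gt_eqF// sumr_ge0// => i _; exact: powR_ge0.
  rewrite (bigD1 (Ordinal nP))//= lerDl sumr_ge0// => i _; exact: powR_ge0.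
- move=> P Q s h1 h2; rewrite mul1r; apply: (powR_le_inv p_gt0).
  + exact: mdist_ge0.
  + exact: powR_ge0.
  rewrite HF -powRrM mulVf ?gt_eqF// powRr1//.
  apply: sum_powR_le => // n; first by rewrite coefB.
  by move=> /h2; rewrite coefB => ->; rewrite subrr.
Qed.

End disjoint_system.
End systems.

Section embeddings.
Variables (R : realType) (p : R) (p1 : (1 <= p%:E)%E).

Lemma distortion_lp_le k : (0 < k)%N ->
  (distortion (diamond R k) (lp p1) <= (6 * k%:R `^ p^-1)%:E)%E.
Proof.
apply: (@distortion_disjoint_system _ _ _ _ _ _ (fun n => [set n]) (fun=> 1)) => //.
- by move=> i j _ _ [x [/= -> ->]].
- move=> n; rewrite /= /counting/=; case: asboolP => [_|[]//].
  by rewrite fset_set1 finmap.cardfs1.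
Qed.

Lemma distortion_Lp01_le k : (0 < k)%N ->
  (distortion (diamond R k) (Lp01 p1) <= (6 * k%:R `^ p^-1)%:E)%E.
Proof.
(* Adjacent half-open intervals accumulating at 0: infinitely many disjoint sets of positive measure
   in the unit interval. *)
pose A (n : nat) : set (measurableTypeR R) := `[n.+2%:R^-1, n.+1%:R^-1[%classic.
have A01 n : A n `<=` `[0, 1]%classic.
  move=> x; rewrite /A /= !in_itv/= => /andP[h1 h2]; apply/andP; split.
    by rewrite (le_trans _ h1).
  by rewrite (le_trans (ltW h2))// invf_le1// ler1n.
apply: (@distortion_disjoint_system _ (measurableTypeR R) R
    (unit_interval_measure R) p p1 A
    (fun n => n.+1%:R^-1 - n.+2%:R^-1)) => //.
- move=> n; exact: measurable_itv.
- suff H i j x : (i < j)%N -> A i x -> A j x -> False.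
    move=> i j _ _ [x [Ai Aj]]; have [ij|ij|//] := ltngtP i j.
      by have := H _ _ _ ij Ai Aj.
    by have := H _ _ _ ij Aj Ai.
  move=> ij; rewrite /A /= !in_itv/= => /andP[h1 _] /andP[_ h2].
  have := le_lt_trans h1 h2; rewrite ltf_pV2 ?posrE ?ltr0n// ltr_nat; lia.
- by move=> n; rewrite subr_gt0 ltf_pV2 ?posrE ?ltr0n// ltr_nat.
- move=> n; rewrite /unit_interval_measure/= /mrestr setIidl//.
  rewrite lebesgue_measure_itv/= lte_fin ltf_pV2 ?posrE ?ltr0n// ltr_nat ltnSn.
  by rewrite -EFinB.
Qed.

End embeddings.

Section restricted_measure.
Context d (T : measurableType d) (R : realType).
Variables (mu : {measure set T -> \bar R}) (D : set T) (mD : measurable D).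

Lemma ge0_integral_mrestr (f : T -> \bar R) : measurable_fun setT f ->
  (forall x, 0 <= f x)%E ->
  (\int[mrestr mu mD]_x f x = \int[mu]_(x in D) f x)%E.
Proof.
move=> mf f0.
rewrite (@ge0_negligible_integral _ _ _ _ setT (~` D))//; last 2 first.
- exact: measurableC.
- by rewrite /= /mrestr setICl measure0.
rewrite setTD setCK; apply: eq_measure_integral => A mA AD.
by rewrite /= /mrestr setIidl.
Qed.

End restricted_measure.

(** * Embedding through orthogonal cosines for p <= 2 *)

Section cosine_system.
Variable R : realType.
Implicit Types f g : R -> R.

Local Notation I01 := (`[0, 1]%classic : set R).

Let cM f g : continuous f -> continuous g -> continuous (fun x => f x * g x).
Proof. by move=> cf cg x; exact: (continuousM (cf x) (cg x)). Qed.

Let cD f g : continuous f -> continuous g -> continuous (fun x => f x + g x).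
Proof. by move=> cf cg x; apply: (@continuousD _ _ _ f g); [exact: cf|exact: cg]. Qed.

Let cC (c : R) : continuous (fun _ : R => c).
Proof. by move=> x; exact: cst_continuous. Qed.

Definition mean f : R := \int[@lebesgue_measure R]_(x in I01) f x.

Lemma continuous_integrable01 f : continuous f ->
  (@lebesgue_measure R).-integrable I01 (EFin \o f).
Proof.
move=> cf; apply: continuous_compact_integrable; first exact: segment_compact.
exact: continuous_subspaceT.
Qed.

Lemma meanD f g : continuous f -> continuous g ->
  mean (fun x => f x + g x) = mean f + mean g.
Proof. by move=> cf cg; rewrite /mean RintegralD//; exact: continuous_integrable01. Qed.

Lemma meanZ (c : R) f : continuous f -> mean (fun x => c * f x) = c * mean f.
Proof. by move=> cf; rewrite /mean RintegralZl//; exact: continuous_integrable01. Qed.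

Lemma mean_cst (c : R) : mean (fun=> c) = c.
Proof.
rewrite /mean Rintegral_cst//= lebesgue_measure_itv/= lte_fin ltr01.
by rewrite oppr0 adde0 mulr1.
Qed.

Lemma continuous_sum n (f : 'I_n -> R -> R) : (forall i, continuous (f i)) ->
  continuous (fun x => \sum_(i < n) f i x).
Proof.
move=> cf; elim: n f cf => [|n IHn] f cf.
  by under eq_fun do rewrite big_ord0; exact: cst_continuous.
under eq_fun do rewrite big_ord_recr/=.
move=> x; apply: (@continuousD _ _ _
  (fun x => \sum_(i < n) f (widen_ord (leqnSn n) i) x) (f ord_max)).
  by apply: (IHn (fun i => f (widen_ord (leqnSn n) i))) => i; exact: cf.
exact: cf.
Qed.

Lemma mean_sum n (f : 'I_n -> R -> R) : (forall i, continuous (f i)) ->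
  mean (fun x => \sum_(i < n) f i x) = \sum_(i < n) mean (f i).
Proof.
elim: n f => [|n IHn] f cf.
  by under eq_fun do rewrite big_ord0; rewrite big_ord0 mean_cst.
under eq_fun do rewrite big_ord_recr/=.
rewrite meanD//; last by apply: continuous_sum => i; exact: cf.
by rewrite big_ord_recr/= IHn// => i; exact: cf.
Qed.

Definition cosine (m : nat) (x : R) := cos (m%:R * (pi *+ 2) * x).

Lemma continuous_cosine m : continuous (cosine m).
Proof.
move=> x; apply: continuous_comp; last exact: continuous_cos.
by apply: continuousM; [exact: cst_continuous|exact: cvg_id].
Qed.

(** The primitive sin(c x) / c, with c = 2 pi m, takes equal values at 0 and 1. *)
Lemma mean_cosine m : (0 < m)%N -> mean (cosine m) = 0.
Proof.
move=> m0; pose c : R := m%:R * (pi *+ 2).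
have c0 : c != 0 by rewrite mulf_neq0// ?pnatr_eq0 -?lt0n// mulrn_eq0/= gt_eqF// pi_gt0.
pose F (x : R) := c^-1 * sin (c * x).
have dF (x : R) : is_derive x 1 F (cosine m x).
  have d1 : is_derive x 1 (c \*: (@id R)) (c *: 1) by exact: is_deriveZ.
  have d2 := @is_derive1_comp _ (@sin R) (c \*: id) x _ _ (is_derive_sin _) d1.
  have := @is_deriveZ _ _ _ (sin \o (c \*: id)) c^-1 x 1 _ d2.
  rewrite /cosine -/c [c *: 1]mulr1 /GRing.scale/=.
  by rewrite mulrCA mulVf// mulr1.
have cF : continuous F.
  by move=> x; apply: differentiable_continuous; apply/derivable1_diffP; case: (dF x).
have := @continuous_FTC2 R (cosine m) F 0 1 ltr01.
rewrite /mean /Rintegral => ->.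
- rewrite /F mulr0 sin0 mulr0 mulr1 /c mulr_natl.
  by rewrite -[X in sin X]add0r (periodicn (@sinD2pi R)) sin0 mulr0 subee.
- exact/continuous_subspaceT/continuous_cosine.
- split=> [x _||]; first by case: (dF x).
  + by apply: cvg_at_right_filter; exact: cF.
  + by apply: cvg_at_left_filter; exact: cF.
- by move=> x _; rewrite derive1E; case: (dF x).
Qed.

Lemma cosineM m n x : (m <= n)%N ->
  cosine m x * cosine n x = 2^-1 * cosine (n - m) x + 2^-1 * cosine (n + m) x.
Proof.
move=> mn; rewrite /cosine natrB// natrD !mulrBl !mulrDl cosB cosD; lra.
Qed.

Lemma mean_cosineM m n : (0 < m)%N -> (0 < n)%N ->
  mean (fun x => cosine m x * cosine n x) = if m == n then 2^-1 else 0.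
Proof.
wlog mn : m n / (m <= n)%N.
  move=> H m0 n0; have [mn|/ltnW nm] := leqP m n; first exact: H.
  by under eq_fun do rewrite mulrC; rewrite H// eq_sym.
move=> m0 n0; under eq_fun do rewrite cosineM//.
have cZ k : continuous (fun x => 2^-1 * cosine k x).
  by apply: cM; [exact: cC|exact: continuous_cosine].
rewrite meanD// !meanZ; do ?exact: continuous_cosine.
rewrite [X in _ + _ * X]mean_cosine ?addn_gt0 ?n0// mulr0 addr0.
have [->|mn'] := eqVneq m n; last by rewrite mean_cosine ?mulr0//; lia.
rewrite subnn (_ : cosine 0 = fun=> 1) ?mean_cst ?mulr1//.
by apply/funext => x; rewrite /cosine !mul0r cos0.
Qed.

(** The shift skips the constant function [cosine 0], whose mean is 1. *)
Let phi n : R -> R := cosine n.+1.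

Lemma continuous_lincomb_cosine (P : {poly R}) : continuous (lincomb phi P).
Proof.
by apply: continuous_sum => i; apply: cM; [exact: cC|exact: continuous_cosine].
Qed.

Lemma mean_lincombM (P : {poly R}) g : continuous g ->
  mean (fun x => lincomb phi P x * g x) =
  \sum_(i < size P) P`_i * mean (fun x => phi i x * g x).
Proof.
move=> cg; rewrite /lincomb; under eq_fun do rewrite mulr_suml.
have cp (i : nat) : continuous (phi i) by exact: continuous_cosine.
have -> : (fun x => \sum_(i < size P) P`_i * phi i x * g x) =
    (fun x => \sum_(i < size P) P`_i * (phi i x * g x)).
  by apply/funext => x; apply: eq_bigr => i _; rewrite mulrA.
rewrite mean_sum => [|i]; last exact/cM/cM.
by apply: eq_bigr => i _; rewrite meanZ//; exact: cM.
Qed.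

Lemma mean_lincomb_cosine (P : {poly R}) n :
  mean (fun x => phi n x * lincomb phi P x) = P`_n / 2.
Proof.
have cp (i : nat) : continuous (phi i) by exact: continuous_cosine.
under eq_fun do rewrite mulrC; rewrite mean_lincombM//.
under eq_bigr do rewrite mean_cosineM// eqSS.
have [nP|Pn] := ltnP n (size P).
  rewrite (bigD1 (Ordinal nP))//= eqxx big1 ?addr0// => i iN.
  by rewrite ifN ?mulr0//; apply: contra iN => /eqP h; apply/eqP/val_inj.
rewrite nth_default// mul0r big1// => i _.
by rewrite ifN ?mulr0// ltn_eqF// (leq_trans _ Pn).
Qed.

Lemma mean_lincomb_sqr (P : {poly R}) :
  mean (fun x => lincomb phi P x ^+ 2) = \sum_(i < size P) P`_i ^+ 2 / 2.
Proof.
under eq_fun do rewrite expr2.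
rewrite mean_lincombM; last exact: continuous_lincomb_cosine.
by apply: eq_bigr => i _; rewrite mean_lincomb_cosine mulrA.
Qed.

Variables (p : R) (p1 : (1 <= p%:E)%E) (p2 : p <= 2).

Let p_ge1 : 1 <= p. Proof. by rewrite -lee_fin. Qed.

Let p_gt0 : 0 < p. Proof. exact: lt_le_trans ltr01 p_ge1. Qed.

Lemma integral01E f : measurable_fun setT f -> (forall x, 0 <= f x) ->
  (\int[unit_interval_measure R]_x (f x)%:E =
   \int[@lebesgue_measure R]_(x in I01) (f x)%:E)%E.
Proof.
move=> mf f0; apply: ge0_integral_mrestr.
  exact/measurable_EFinP.
by move=> x; rewrite lee_fin.
Qed.

Lemma integral_mean f : continuous f ->
  (\int[@lebesgue_measure R]_(x in I01) (f x)%:E)%E = (mean f)%:E.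
Proof.
move=> cf; rewrite /mean /Rintegral fineK//.
exact/integrable_fin_num/continuous_integrable01.
Qed.

Lemma measurable_powR_continuous f : continuous f ->
  measurable_fun setT (fun x => `|f x| `^ p).
Proof.
move=> cf; apply: (@measurableT_comp _ _ _ _ _ _ (@powR R ^~ p)) => //.
by apply: measurableT_comp => //; exact: continuous_measurable_fun.
Qed.

Lemma powR_le_1_sqr (x : R) : `|x| `^ p <= 1 + x ^+ 2.
Proof.
have x2 := sqr_ge0 x; have [x1|x1] := leP `|x| 1.
  apply: (@le_trans _ _ (1 `^ p)); last by rewrite powR1 lerDl.
  by rewrite ge0_ler_powR ?nnegrE ?(ltW p_gt0).
apply: (@le_trans _ _ (`|x| `^ 2)); first by rewrite ler_powR// ltW.
by rewrite powR_mulrn// real_normK ?num_real// lerDr.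
Qed.

Lemma le_1_powR (x : R) : 0 <= x -> x <= 1 + x `^ p.
Proof.
move=> x0; have [x1|x1] := leP x 1; first by rewrite (le_trans x1)// lerDl powR_ge0.
by rewrite (le_trans (le1r_powR (ltW x1) p_ge1))// lerDr.
Qed.

(** Integrating |y|^p <= 1 + y^2 at y = f / B bounds the integral by 2 B^p, and 2 <= 2^p. *)
Lemma integral_powR_le f (B : R) : continuous f -> 0 < B ->
  mean (fun x => f x ^+ 2) <= B ^+ 2 ->
  (\int[unit_interval_measure R]_x (`|f x| `^ p)%:E <= ((2 * B) `^ p)%:E)%E.
Proof.
move=> cf B0 fB; rewrite integral01E; last 2 first.
- exact: measurable_powR_continuous.
- by move=> x; exact: powR_ge0.
have cf2 : continuous (fun x => f x ^+ 2).
  by under eq_fun do rewrite expr2; apply: cM.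
pose h x := B `^ p * (1 + (B ^+ 2)^-1 * f x ^+ 2).
have c2 : continuous (fun x => (B ^+ 2)^-1 * f x ^+ 2) by exact: cM.
have c3 : continuous (fun x => 1 + (B ^+ 2)^-1 * f x ^+ 2).
  exact: cD.
have ch : continuous h by exact: cM.
apply: (@le_trans _ _ (\int[@lebesgue_measure R]_(x in I01) (h x)%:E)%E).
  apply: ge0_le_integral => //.
  - by apply/measurable_EFinP; apply: measurable_funTS;
      exact: measurable_powR_continuous.
  - by apply/measurable_EFinP; apply: measurable_funTS;
      exact: continuous_measurable_fun.
  - move=> x _; rewrite lee_fin /h.
    have -> : `|f x| `^ p = B `^ p * `|f x / B| `^ p.
      rewrite -powRM ?(ltW B0)// normrM normfV (gtr0_norm B0).
      by rewrite mulrC divfK ?gt_eqF.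
    rewrite ler_pM2l ?powR_gt0//; apply: le_trans (powR_le_1_sqr _) _.
    by rewrite expr_div_n mulrC.
rewrite integral_mean// lee_fin /h meanZ// meanD// mean_cst meanZ//.
rewrite powRM ?(ltW B0)// mulrC ler_pM2r ?powR_gt0//.
apply: (@le_trans _ _ 2).
  have : (B ^+ 2)^-1 * mean (fun x => f x ^+ 2) <= 1.
    by rewrite ler_pdivrMl ?exprn_gt0// mulr1.
  lra.
by rewrite le1r_powR// ler1n.
Qed.

(** Cosines are bounded by one, and |y| <= 1 + |y|^p at y = f / B integrates to at most 2. *)
Lemma mean_le_norm f (B : R) m : continuous f -> 0 < B ->
  (\int[unit_interval_measure R]_x (`|f x| `^ p)%:E <= (B `^ p)%:E)%E ->
  `|mean (fun x => cosine m x * f x)| <= 2 * B.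
Proof.
move=> cf B0; rewrite integral01E; last 2 first.
- exact: measurable_powR_continuous.
- by move=> x; exact: powR_ge0.
move=> fB.
have cc : continuous (fun x => cosine m x * f x).
  by apply: cM => //; exact: continuous_cosine.
apply: le_trans (le_normr_Rintegral _ (continuous_integrable01 cc)) _ => //.
rewrite -[X in X <= _]/(mean (fun x => `|cosine m x * f x|)).
have cn : continuous (fun x => `|cosine m x * f x|).
  by move=> x; apply: continuous_comp (cc x) _; exact: norm_continuous.
rewrite -lee_fin -integral_mean//.
have mp : measurable_fun I01 (fun x => `|f x| `^ p).
  by apply: measurable_funTS; exact: measurable_powR_continuous.
have Bp := powR_gt0 p B0.
apply: (@le_trans _ _ (\int[@lebesgue_measure R]_(x in I01)
    (B%:E + (B / B `^ p)%:E * (`|f x| `^ p)%:E))%E).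
  apply: ge0_le_integral => //.
  - by apply/measurable_EFinP; apply: measurable_funTS;
      exact: continuous_measurable_fun.
  - apply: emeasurable_funD => //; apply: measurable_funeM.
    exact/measurable_EFinP.
  - move=> x _; rewrite -EFinM -EFinD lee_fin normrM.
    apply: (@le_trans _ _ `|f x|).
      by rewrite ler_piMl// ler_norml cos_geN1 cos_le1.
    have := @le_1_powR (`|f x| / B).
    rewrite divr_ge0 ?(ltW B0)// => /(_ isT).
    rewrite -(ler_pM2l B0) mulrC divfK ?gt_eqF// => H; apply: le_trans H _.
    rewrite mulrDr mulr1 powRM ?invr_ge0 ?(ltW B0)// lerD2l.
    rewrite -powR_inv1 ?(ltW B0)// -powRrM mulN1r powRN.
    by rewrite mulrA mulrAC.
rewrite ge0_integralD//; last 3 first.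
- by move=> x _; rewrite lee_fin ltW.
- by move=> x _; rewrite -EFinM lee_fin mulr_ge0 ?powR_ge0// divr_ge0 ?ltW.
- by apply: measurable_funeM; exact/measurable_EFinP.
rewrite ge0_integralZl//; do ?
  [exact/measurable_EFinP|by rewrite lee_fin divr_ge0 ?ltW].
rewrite integral_mean// mean_cst.
apply: (@le_trans _ _ (B%:E + (B / B `^ p)%:E * (B `^ p)%:E)%E).
  by rewrite leeD2l// lee_wpmul2l// lee_fin divr_ge0 ?ltW.
by rewrite -EFinM -EFinD lee_fin divfK ?gt_eqF//; lra.
Qed.

(** A coefficient is twice a mean against a cosine, so it is at most 4 times the distance, giving al
    = 1/4; comparison with the L_2 norm gives be = 2. Thus 48 = 6 (2 / (1/4)). *)
Lemma distortion_Lp01_le_sqrt k : (0 < k)%N ->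
  (distortion (diamond R k) (Lp01 p1) <= (48 * k%:R `^ 2^-1)%:E)%E.
Proof.
move=> k0.
have [n|P|F HF] := @Lp_system _ _ R (unit_interval_measure R) p p1 phi.
- by apply: continuous_measurable_fun; exact: continuous_cosine.
- pose B := 1 + mean (fun x => lincomb phi P x ^+ 2).
  have M0 : 0 <= mean (fun x => lincomb phi P x ^+ 2).
    by apply: Rintegral_ge0 => x _; exact: sqr_ge0.
  have B1 : 1 <= B by rewrite lerDl.
  have BB : mean (fun x => lincomb phi P x ^+ 2) <= B ^+ 2.
    by rewrite /B in B1 *; nra.
  apply: le_lt_trans (integral_powR_le _ _ BB) _; last exact: ltry.
    exact: continuous_lincomb_cosine.
  by rewrite (lt_le_trans ltr01).
have := @distortion_diamond_le R k (Lp01 p1) F (4^-1) 2 2 k0.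
have -> : 6 * (2 / 4^-1) = 48 :> R by field.
apply.
- by rewrite invr_gt0.
- lra.
- by rewrite ler1n.
- move=> P Q n; rewrite -coefB mulrC ler_pdivrMr//.
  (* [mean_le_norm] needs a positive bound, while the distance may vanish; the slack e / 4 becomes e
     after the factor 4. *)
  apply/ler_addgt0Pl => e e0; pose B := mdist (F P) (F Q) + e / 4.
  have e4 : 0 < e / 4 by rewrite divr_gt0.
  have B0 : 0 < B by rewrite ltr_wpDl ?mdist_ge0.
  have h : (\int[unit_interval_measure R]_x
      (`|lincomb phi (P - Q) x| `^ p)%:E <= (B `^ p)%:E)%E.
    rewrite -HF lee_fin ge0_ler_powR ?nnegrE ?mdist_ge0 ?(ltW p_gt0) ?(ltW B0)//.
    by rewrite /B lerDl ltW.
  have := mean_le_norm n.+1 (@continuous_lincomb_cosine (P - Q)) B0 h.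
  rewrite -[cosine n.+1]/(phi n) mean_lincomb_cosine normrM (@ger0_norm _ 2^-1)//.
  by rewrite /B; lra.
- move=> P Q s h1 h2.
  have c2 : \sum_(i < size (P - Q)%R) (P - Q)%R`_i ^+ 2 / 2 <= (size s)%:R.
    rewrite -mulr_suml ler_pdivrMr//.
    apply: (@le_trans _ _ (size s)%:R); last by rewrite ler_peMr ?ler1n.
    under eq_bigr do rewrite -real_normK ?num_real// -powR_mulrn//.
    apply: sum_powR_le => // n; first by rewrite coefB.
    by move=> /h2; rewrite coefB => ->; rewrite subrr.
  (* For empty [s] the bound passed to [integral_powR_le] would be 0 instead of positive. *)
  have [s0|s0] := posnP (size s).
    have -> : P = Q by apply/polyP => n; apply: h2; rewrite (size0nil s0).
    by rewrite mdistxx mulr_ge0 ?powR_ge0.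
  apply: (powR_le_inv p_gt0); rewrite ?mdist_ge0 ?mulr_ge0 ?powR_ge0//.
  rewrite -lee_fin HF; apply: integral_powR_le.
  + exact: continuous_lincomb_cosine.
  + by rewrite powR_gt0 ?ltr0n.
  + by rewrite mean_lincomb_sqr -powR_mulrn ?powR_ge0// -powRrM mulVf// powRr1.
Qed.

End cosine_system.

(** * Explicit constants for both estimates *)

Section bounds.
Variables (R : realType) (p : R) (p1 : (1 <= p%:E)%E) (k : nat).

Let p_ge1 : 1 <= p. Proof. by rewrite -lee_fin. Qed.

Let p_gt0 : 0 < p. Proof. exact: lt_le_trans ltr01 p_ge1. Qed.

(** The constant c = 1/2 of [convex_midpoints_lp] enters as (1/2)^(1/p) >= 1/2, and the general
    lower bound halves it again. *)
Lemma distortion_lp_ge :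
  ((4^-1 * k%:R `^ p^-1)%:E <= distortion (diamond R k) (lp p1))%E.
Proof.
have c0 : 0 <= 2^-1 :> R by [].
apply: (le_trans _
  (distortion_diamond_ge k p_gt0 c0 (@convex_midpoints_lp R p p1))).
rewrite lee_fin powRM// mulrAC ler_wpM2r ?powR_ge0//.
have : 2^-1 <= 2^-1 `^ p^-1 :> R.
  by apply: ger1_powR; [apply/andP; split; lra|rewrite invf_le1].
lra.
Qed.

Lemma distortion_Lp01_ge_powR : 2 <= p ->
  ((2^-1 * k%:R `^ p^-1)%:E <= distortion (diamond R k) (Lp01 p1))%E.
Proof.
move=> p2; have := @convex_midpoints_Lp_ge2 R _ _ (unit_interval_measure R) p p1 p2.
move=> /(distortion_diamond_ge k p_gt0 ler01) h; apply: (le_trans _ h).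
by rewrite lee_fin mul1r mulrC.
Qed.

Lemma distortion_Lp01_ge_sqrt : 1 < p < 2 ->
  ((Num.sqrt (p - 1) / 2 * Num.sqrt k%:R)%:E <=
    distortion (diamond R k) (Lp01 p1))%E.
Proof.
move=> p12; have /andP[p1' p2] := p12; have c0 : 0 <= p - 1 by lra.
have := @convex_midpoints_Lp_lt2 R _ _ (unit_interval_measure R) p p1 p12.
move=> /(distortion_diamond_ge k (@ltr0Sn R 1) c0) h; apply: (le_trans _ h).
by rewrite lee_fin powR12_sqrt ?mulr_ge0// sqrtrM// mulrAC.
Qed.

Hypothesis k_gt0 : (0 < k)%N.

Let k_ge1 : 1 <= k%:R :> R. Proof. by rewrite ler1n. Qed.

Lemma powR_sqrt_min : Num.min (k%:R `^ p^-1) (Num.sqrt k%:R) =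
  if 2 <= p then k%:R `^ p^-1 else k%:R `^ 2^-1.
Proof.
rewrite -powR12_sqrt//; case: ifPn => p2.
  by rewrite min_l// ler_powR// lef_pV2 ?posrE.
by rewrite min_r// ler_powR// lef_pV2 ?posrE// ltW// ltNge.
Qed.

Lemma distortion_Lp01_le_min : (distortion (diamond R k) (Lp01 p1) <=
  (48 * Num.min (k%:R `^ p^-1) (Num.sqrt k%:R))%:E)%E.
Proof.
rewrite powR_sqrt_min; case: ifPn => p2.
  apply: le_trans (distortion_Lp01_le p1 k_gt0) _.
  by rewrite lee_fin ler_wpM2r ?powR_ge0// ler_nat.
by apply: distortion_Lp01_le_sqrt => //; rewrite ltW// ltNge.
Qed.

(** For p < 2 the constant sqrt(p - 1) / 2 degenerates as p tends to 1; by monotonicity its value at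
    [p0] serves all p >= p0. *)
Lemma distortion_Lp01_ge_min p0 : 1 < p0 -> p0 <= p ->
  ((Num.min 1 (Num.sqrt (p0 - 1)) / 2 *
    Num.min (k%:R `^ p^-1) (Num.sqrt k%:R))%:E <=
      distortion (diamond R k) (Lp01 p1))%E.
Proof.
move=> p01 p0p; rewrite powR_sqrt_min; case: ifPn => p2.
  apply: (le_trans _ (distortion_Lp01_ge_powR p2)); rewrite lee_fin.
  apply: ler_wpM2r; first exact: powR_ge0.
  by rewrite ler_pdivrMr// mulVf ?pnatr_eq0// ge_min lexx.
have p12 : 1 < p < 2 by rewrite (lt_le_trans p01)//= ltNge.
apply: (le_trans _ (distortion_Lp01_ge_sqrt p12)); rewrite lee_fin powR12_sqrt//.
rewrite ler_wpM2r ?sqrtr_ge0// ler_wpM2r// ge_min; apply/orP; right.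
by rewrite ler_sqrt ?lerB// subr_ge0 ltW// (lt_le_trans p01).
Qed.

End bounds.

Unset Implicit Arguments.

Theorem theorem3 (R : realType) :
  (exists c C : R, [/\ 0 < c, 0 < C &
    forall (p : R) (p1 : (1 <= p%:E)%E) (k : nat), (0 < k)%N ->
      ((c * k%:R `^ p^-1)%:E <= distortion (diamond R k) (lp p1)
        <= (C * k%:R `^ p^-1)%:E)%E])
  /\
  (exists2 C : R, 0 < C & forall p0 : R, 1 < p0 -> exists2 c : R, 0 < c &
    forall (p : R) (p1 : (1 <= p%:E)%E) (k : nat), p0 <= p -> (0 < k)%N ->
      ((c * Num.min (k%:R `^ p^-1) (Num.sqrt k%:R))%:E
          <= distortion (diamond R k) (Lp01 p1)
          <= (C * Num.min (k%:R `^ p^-1) (Num.sqrt k%:R))%:E)%E).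
Proof.
split.
  exists 4^-1, 6; split=> // p p1 k k0.
  by rewrite distortion_lp_ge distortion_lp_le.
exists 48 => // p0 p01; exists (Num.min 1 (Num.sqrt (p0 - 1)) / 2).
  by rewrite divr_gt0// lt_min ltr01 sqrtr_gt0 subr_gt0.
by move=> p p1 k p0p k0; rewrite distortion_Lp01_ge_min// distortion_Lp01_le_min.
Qed.
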